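(* Let $\Omega\subset\mathbb{R}^d$ be a bounded open set, let $f$ be a signed measure of finite mass on $\Omega$, and let $\psi:[0,+\infty)\to[0,+\infty]$ be convex and of linear growth, i.e. $$\lim_{s\to+\infty}\frac{\psi(s)}{s}=k\quad\text{for some } k\in(0,+\infty).$$ Let $\mathscr{M}(\Omega)$ be the class of nonnegative measures (of finite mass) on $\Omega$, and for $a\in\mathscr{M}(\Omega)$ set $$\mathcal{E}(a)=\inf_{u\in C^1_0(\Omega)}\left\{\frac12\int_\Omega|\nabla u|^2\,da-\int_\Omega u\,df-\frac12\int_\Omega\psi(a)\right\}.$$ Assume that $f$ is such that $\mathcal{E}(a)>-\infty$ for at least one coefficient $a\in\mathscr{M}(\Omega)$. Then the functional $\mathcal{E}$ admits a maximizer $a_{opt}$ in the class $\mathscr{M}(\Omega)$: $a_{opt}\in\mathscr{M}(\Omega)$ and $\mathcal{E}(a_{opt})\ge\mathcal{E}(a)$ for every $a\in\mathscr{M}(\Omega)$.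
   Context: $C^1_0(\Omega)$ denotes the usual space of real-valued $C^1$ functions on $\Omega$ with zero boundary values. The integral $\int_\Omega\psi(a)$ of a convex function of a measure is understood in the usual sense: if $a=a^{ac}(x)\,dx+a^{s}$ is the Lebesgue decomposition of $a$, with $a^s$ singular with respect to Lebesgue measure, then $$\int_\Omega\psi(a)=\int_\Omega\psi(a^{ac}(x))\,dx+k\,a^{s}(\Omega).$$ If this integral is $+\infty$, then $\mathcal{E}(a)=-\infty$.
   Formalization: ψ is additionally assumed lower semicontinuous on [0,+∞); without this the claim fails, e.g. for nonempty Ω, f = 0, ψ(0) = 1, ψ(s) = s for s > 0, where the supremum 0 of the functional is not attained. *)

(* Defs.v *)
From HB Require Import structures.
From mathcomp Require Import all_boot all_order all_algebra.
From mathcomp Require Import all_classical all_reals all_analysis.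
From mathcomp Require Import measurable_realfun.

Set Implicit Arguments.
Unset Strict Implicit.
Unset Printing Implicit Defensive.

Import Order.TTheory GRing.Theory Num.Theory.
Import numFieldNormedType.Exports.

Local Open Scope classical_set_scope.
Local Open Scope ring_scope.
Local Open Scope ereal_scope.

Definition borelRV (R : realType) (d : nat) :=
  g_sigma_algebraType (@open 'rV[R]_d).

HB.instance Definition _ (R : realType) (d : nat) :=
  Measurable.on (borelRV R d).

Section lebesgueRV.
Variable R : realType.

Definition consRV d (p : measurableTypeR R * borelRV R d) : borelRV R d.+1 :=
  row_mx (p.1%:M : 'rV[R]_1) (p.2 : 'rV[R]_d).

Definition unconsRV d (v : borelRV R d.+1) :
    measurableTypeR R * borelRV R d :=
  ((lsubmx (v : 'rV[R]_(1 + d)) 0 0)%R, rsubmx (v : 'rV[R]_(1 + d))).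

Lemma unconsRVK d : cancel (@unconsRV d) (@consRV d).
Proof.
move=> v; rewrite /consRV /unconsRV /= -mx11_scalar.
exact: (@hsubmxK _ 1 1 d v).
Qed.

Lemma consRVK d : cancel (@consRV d) (@unconsRV d).
Proof.
by case=> x y; rewrite /consRV /unconsRV row_mxKl row_mxKr mxE eqxx mulr1n.
Qed.
Lemma measurable_openRV d (U : set 'rV[R]_d) :
  open U -> measurable (U : set (borelRV R d)).
Proof. by move=> oU; exact: sub_sigma_algebra. Qed.

Lemma measurable_consRV d : measurable_fun setT (@consRV d).
Proof.
apply: (@measurability _ _ _ _ setT (@consRV d) (@open 'rV[R]_d.+1)) => //.
move=> _ [U oU <-]; rewrite setTI.
pose box (i : rat * 'rV[rat]_d * nat) :
    set (measurableTypeR R * borelRV R d) :=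
  ball (ratr i.1.1 : R) i.2.+1%:R^-1%R `*`
  ball (map_mx ratr i.1.2 : 'rV[R]_d) i.2.+1%:R^-1%R.
have -> : @consRV d @^-1` U = \bigcup_i
    (if pselect (box i `<=` @consRV d @^-1` U) then box i else set0).
  apply/seteqP; split => [[x y] /= Uxy|p [i _]]; last first.
    by case: pselect => // sub; exact: sub.
  have /nbhs_ballP[e /= e0 He] : nbhs (consRV (x, y) : 'rV[R]_d.+1) U.
    by apply: open_nbhs_nbhs; split.
  have [n ne] : exists n : nat, (n.+1%:R^-1 < e / 2 :> R)%R.
    have e2 : (0 < e / 2)%R by rewrite divr_gt0.
    have [N _ /(_ N)] := near_infty_natSinv_lt (PosNum e2).
    by move=> /(_ (leqnn N)) ?; exists N.
  have n0 : (0 < n.+1%:R^-1 :> R)%R by rewrite invr_gt0.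
  have ratc (z : R) : exists q : rat, (`|ratr q - z| < n.+1%:R^-1)%R.
    have [|q] := @rat_in_itvoo R (z - n.+1%:R^-1)%R (z + n.+1%:R^-1)%R.
      by rewrite ltrD2l gtrN.
    rewrite in_itv /= => qz; exists q.
    by rewrite ltr_distl.
  have [q1 hq1] := ratc x.
  pose q2 : 'rV[rat]_d := \row_j sval (cid (ratc ((y : 'rV[R]_d) 0%R j))).
  have hq2 j : (`|ratr (q2 0%R j) - (y : 'rV[R]_d) 0%R j| < n.+1%:R^-1)%R.
    by rewrite mxE; case: cid.
  exists (q1, q2, n) => //.
  have inbox : box (q1, q2, n) (x, y).
    split => //=; split => // i j; rewrite ord1 mxE; exact: (hq2 j).
  case: pselect => // -[] [x' y'] [/= bx [_ by_]]; apply: He.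
  split => // i j; rewrite ord1 {i} /consRV /=.
  have tri (a b c : R) : (`|c - a| < n.+1%:R^-1 -> `|c - b| < n.+1%:R^-1 ->
      `|a - b| < e)%R.
    move=> ca cb; rewrite (le_lt_trans (ler_distD c _ _))// distrC.
    by rewrite [ltRHS]splitr ltrD// (lt_trans _ ne).
  rewrite !mxE; case: (@fintype.split 1%N d j) => k.
    rewrite !mxE !ord1 eqxx !mulr1n; exact: (tri _ _ (ratr q1)).
  apply: (tri _ _ (ratr (q2 0%R k))); first exact: (hq2 k).
  by have := by_ 0%R k; rewrite mxE.
apply: countable_bigcupT_measurable => [|i].
  exact: countableP.
case: pselect => ? /=; last exact: measurable0.
apply: measurableX.
  by apply: open_measurable; exact: ball_open.
by apply: measurable_openRV; exact: ball_open.
Qed.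

Lemma measurable_unconsRV d : measurable_fun setT (@unconsRV d).
Proof.
apply: measurable_fun_pair => /=.
  apply: (measurability _ (RGenOpens.measurableE R)) => // _ [_ [x [y ->]] <-].
  rewrite setTI; apply: measurable_openRV.
  have -> : (fun v : 'rV[R]_d.+1 => lsubmx (v : 'rV[R]_(1 + d)) 0%R 0%R) =
      (fun v => v 0%R 0%R).
    by apply/funext => v; rewrite mxE; congr (v _ _); exact/val_inj.
  apply: open_comp; last exact: itv_open.
  by move=> v _; exact: coord_continuous.
apply: (@measurability _ _ _ (borelRV R d) setT
  (fun v : borelRV R d.+1 => rsubmx (v : 'rV[R]_(1 + d)))
  (@open 'rV[R]_d)) => //.
move=> _ [U oU <-]; rewrite setTI.
suff oV : @open 'rV[R]_(1 + d)
    [set v | U (rsubmx (v : 'rV[R]_(1 + d)))] by exact: measurable_openRV.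
rewrite openE => v /= Uv.
have /nbhs_ballP[e /= e0 He] : nbhs (rsubmx (v : 'rV[R]_(1 + d))) U.
  by apply: open_nbhs_nbhs; split.
apply/nbhs_ballP; exists e => //= w [_ vw]; apply: He.
by split => // i j; rewrite !mxE; exact: vw.
Qed.

Definition pushRV d (m : {sigma_finite_measure set (borelRV R d) -> \bar R}) :=
  pushforward (@lebesgue_measure R \x m) (@consRV d).

Section pushRV.
Variables (d : nat) (m : {sigma_finite_measure set (borelRV R d) -> \bar R}).

Let mp : {measure set (borelRV R d.+1) -> \bar R} :=
  @measure_function_pushforward__canonical__measure_function_Measure
    _ _ _ _ R (@lebesgue_measure R \x m) (@consRV d) (@measurable_consRV d).

Let pushRV0 : pushRV m set0 = 0.
Proof. exact: (measure0 mp). Qed.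

Let pushRV_ge0 A : 0 <= pushRV m A.
Proof. exact: (measure_ge0 mp). Qed.

Let pushRV_sigma_additive : semi_sigma_additive (pushRV m).
Proof. exact: (@measure_semi_sigma_additive _ _ _ mp). Qed.

HB.instance Definition _ := isMeasure.Build _ _ _ (pushRV m)
  pushRV0 pushRV_ge0 pushRV_sigma_additive.

Let sigma_finite_pushRV : sigma_finite setT (pushRV m).
Proof.
have /sigma_finiteP[F [TF ndF Foo]] := sigma_finiteT (@lebesgue_measure R).
have /sigma_finiteP[G [TG ndG Goo]] := sigma_finiteT m.
exists (fun n => @unconsRV d @^-1` (F n `*` G n)) => [|n].
  apply/seteqP; split => // v _; case vxy : (unconsRV v) => [x y].
  have : setT x by []; rewrite TF => -[n _ Fnx].
  have : setT y by []; rewrite TG => -[k _ Gky].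
  exists (maxn n k) => //.
  change ((F (maxn n k) `*` G (maxn n k)) (unconsRV v)).
  rewrite vxy; split => /=.
    by move: x Fnx {vxy}; exact/subsetPset/ndF/leq_maxl.
  by move: y Gky {vxy}; exact/subsetPset/ndG/leq_maxr.
have [mF Fn] := Foo n; have [mG Gn] := Goo n; split.
  rewrite -[X in measurable X]setTI; apply: measurable_unconsRV => //.
  exact: measurableX.
rewrite /pushRV /pushforward -comp_preimage (_ : _ \o _ = id); last first.
  by apply/funext => p /=; exact: consRVK.
by rewrite preimage_id product_measure1E// lte_mul_pinfty// ge0_fin_numE.
Qed.

HB.instance Definition _ := Measure_isSigmaFinite.Build _ _ _ (pushRV m)
  sigma_finite_pushRV.

End pushRV.

End lebesgueRV.

(** Lebesgue measure on R^(d+1) is the image of the product of the Lebesgue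
    measures on R and R^d under [(x, v) |-> row_mx x v]. *)
Fixpoint lebesgueRV (R : realType) (d : nat) :
    {sigma_finite_measure set (borelRV R d) -> \bar R} :=
  match d with
  | 0%N => \d_(0%R : borelRV R 0)
  | d'.+1 => pushRV (lebesgueRV R d')
  end.

Section energy.
Variables (R : realType) (d : nat).
Implicit Types (Omega : set 'rV[R]_d) (u : 'rV[R]_d -> R).

(** Measures on an open set [Omega] are represented by measures on R^d that
    do not charge the complement of [Omega]; likewise for signed measures. *)
Definition concentrated_on (mu : set (borelRV R d) -> \bar R) Omega :=
  forall A : set (borelRV R d), measurable A -> A `<=` ~` Omega -> mu A = 0.

Definition finite_measures_on Omega :
    set {finite_measure set (borelRV R d) -> \bar R} :=
  [set a | concentrated_on a Omega].

Definition pderiv u (i : 'I_d) (x : 'rV[R]_d) : R := 'D_(delta_mx 0%R i) u x.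

(** Squared Euclidean norm of the gradient (the library norm on ['rV[R]_d] is
    the sup norm). *)
Definition sqnorm_grad u (x : 'rV[R]_d) : R := (\sum_(i < d) pderiv u i x ^+ 2)%R.

(** C^1 functions on [Omega] with zero boundary values; only the values of [u]
    on [Omega] matter. *)
Definition C10 Omega : set ('rV[R]_d -> R) :=
  [set u | [/\ forall x, Omega x -> differentiable u x,
               forall i x, Omega x -> {for x, continuous (pderiv u i)} &
               forall x, (closure Omega `\` Omega) x ->
                 u @ within Omega (nbhs x) --> (0%R : R)]].

(** Integral with respect to a signed measure, through its Jordan
    decomposition; it does not depend on the chosen Hahn decomposition. *)
Definition charge_integral (f : {charge set (borelRV R d) -> \bar R})
    (D : set (borelRV R d)) (g : borelRV R d -> \bar R) : \bar R :=
  let P := cid (Hahn_decomposition f) in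
  let N := cid (svalP P) in
  \int[jordan_pos (svalP N)]_(x in D) g x
    - \int[jordan_neg (svalP N)]_(x in D) g x.

(** [h] is the density of the absolutely continuous part of [a], and [s] is
    its singular part. *)
Definition lebesgue_decomposition (a : {measure set (borelRV R d) -> \bar R})
    (h : borelRV R d -> R) (s : {measure set (borelRV R d) -> \bar R}) :=
  [/\ measurable_fun setT h,
      forall x, (0 <= h x)%R,
      exists N : set (borelRV R d),
        [/\ measurable N, lebesgueRV R d N = 0 & s (~` N) = 0] &
      forall A, measurable A ->
        a A = \int[lebesgueRV R d]_(x in A) (h x)%:E + s A].

(** The decomposition exists for finite [a], and is unique up to Lebesgue-null
    modifications of [h], so that exactly one value is selected by [get]. *)
Definition convex_integral (psi : R -> \bar R) (k : R) Omega
    (a : {measure set (borelRV R d) -> \bar R}) : \bar R :=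
  get [set r | exists h s, lebesgue_decomposition a h s /\
    r = \int[lebesgueRV R d]_(x in Omega) psi (h x) + k%:E * s Omega].

(** When the integral of [psi] is [+oo], the infimum is [-oo], since [u = 0]
    contributes the value [-oo]. *)
Definition energy (f : {charge set (borelRV R d) -> \bar R})
    (psi : R -> \bar R) (k : R) Omega
    (a : {measure set (borelRV R d) -> \bar R}) : \bar R :=
  ereal_inf [set (2^-1)%:E * \int[a]_(x in Omega) (sqnorm_grad u x)%:E
                 - charge_integral f Omega (fun x => (u x)%:E)
                 - (2^-1)%:E * convex_integral psi k Omega a
            | u in C10 Omega].

End energy.

Section growth.
Variable R : realType.
Implicit Type psi : R -> \bar R.

(** A function [0, +oo) -> [0, +oo] is represented by a function on R of which
    only the values at nonnegative reals are used. *)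
Definition nneg_valued psi := forall s : R, (0 <= s)%R -> 0 <= psi s.

Definition convex_on_nneg psi := forall s t p : R,
  (0 <= s)%R -> (0 <= t)%R -> (0 <= p <= 1)%R ->
  psi (p * s + (1 - p) * t)%R <= p%:E * psi s + (1 - p)%:E * psi t.

(** Part of the usual meaning of the integral of a convex function of a
    measure. Without it maximizers may fail to exist: take [f = 0], [psi 0 = 1]
    and [psi s = s] for [s > 0]. *)
Definition lsc_on_nneg psi := forall s r : R, (0 <= s)%R -> r%:E < psi s ->
  \forall t \near s, (0 <= t)%R -> r%:E < psi t.

Definition linear_growth psi (k : R) :=
  psi s * (s^-1)%:E @[s --> (+oo)%R] --> k%:E.

End growth.

(* Main.v *)
From HB Require Import structures.
Require Import Defs.
From mathcomp Require Import all_boot all_order all_algebra.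
From mathcomp Require Import all_classical all_reals all_analysis.
From mathcomp Require Import measurable_realfun.
From mathcomp Require Import ring lra.

(** The maximizer is obtained by the direct method: [a |-> energy f psi k Omega a]
    is an infimum of functionals, one for each test function, and the point is
    that a maximizing sequence has a limit along which each of these functionals
    that matters is upper semicontinuous.

    Compactness.  Testing with [u = 0] bounds the integral of [psi a_n] along a
    maximizing sequence; by linear growth, and because [Omega] is bounded, this
    bounds the masses of the [a_n] ([mass_bound]).  The limit is taken along an
    ultrafilter on the indices: [m A = lim a_n A] then exists for every Borel set
    [A], and [m] is finitely additive.  The outer measure generated by the values
    of [m] on open sets restricts to a Borel measure [mu] with [mu U <= m U] for
    [U] open and [m K <= mu K] for [K] compact ([outer_regularization],
    [weak_compactness]).  Mass may be lost to the boundary of [Omega], so the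
    candidate is the restriction of [mu] to [Omega].

    Test functions.  The gradient of a [C^1] function vanishing on the boundary
    may blow up there, hence the Dirichlet term is not continuous for this
    convergence.  Composing [u] with a soft threshold gives a function [v] of
    the same class that is uniformly close to [u], with [|grad v| <= |grad u|] and
    with gradient supported in a compact subset of [Omega] ([C10_truncation]).  It
    is enough to test with such [v]: replacing [u] by [v] does not increase the
    Dirichlet term and changes the integral against [f] by as little as wanted.
    For such [v] the Dirichlet integral is upper semicontinuous, by the layer-cake
    formula and the inequality [m K <= mu K] on the compact superlevel sets.

    Lower semicontinuity of the integral of [psi a].  Being convex and lower
    semicontinuous, [psi] is the supremum of countably many affine functions
    [s |-> al * s + be], with slopes [al <= k] that come arbitrarily close to [k]
    ([exists_minorant_sequence], [affine_minorant_slope]).  This gives the dual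
    formula: the integral of [psi a] over [Omega] is the supremum of the sums
    [al_i * a B_i + be_i * |B_i|] over finite families of disjoint Borel sets
    [B_i] ([convex_integral_ge], [convex_integral_le]).  By regularity the [B_i] may
    be replaced by disjoint open sets [U_i], chosen so that [m U_i] is close to
    [mu B_i] ([borel_families_bound]).  For fixed open sets such a sum involves only
    the numbers [a_n U_i], which converge to [m U_i].  The lower semicontinuity
    and the upper semicontinuity of the Dirichlet term are combined in
    [weak_limit_convex_integral]. *)

Set Implicit Arguments.
Unset Strict Implicit.
Unset Printing Implicit Defensive.

Import Order.TTheory GRing.Theory Num.Theory.
Import numFieldNormedType.Exports.

Local Open Scope classical_set_scope.
Local Open Scope ring_scope.

(** * Open sets of a normed space *)

Section metric_topology.
Context {R : realType} {T : normedModType R}.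
Implicit Types (W : set T) (n : nat).

Definition inner_core W n : set T := [set x | ball x n.+1%:R^-1 `<=` W].

Lemma inner_core_sub W n : inner_core W n `<=` W.
Proof. by move=> x; apply; apply: ballxx; rewrite invr_gt0. Qed.

Lemma closed_inner_core W n : closed (inner_core W n).
Proof.
have -> : inner_core W n = ~` \bigcup_(y in ~` W) ball y n.+1%:R^-1.
  apply/seteqP; split => x /=.
    by move=> xW [y /= Wy] /ball_sym /xW.
  move=> xW y xy; apply: contrapT => Wy; apply: xW.
  by exists y => //; exact: ball_sym.
apply: open_closedC; apply: bigcup_open => y _; exact: ball_open.
Qed.

(** The quantified version of openness needed for exhaustions: points whose
    distance to [x] is below [1/(n+1) - 1/(n+2)] lie in the next core. *)
Lemma inner_core_interior W n : inner_core W n `<=` interior (inner_core W n.+1).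
Proof.
move=> x xW; apply/nbhs_ballP.
have lt : (n.+2%:R^-1 < n.+1%:R^-1 :> R)%R by rewrite ltf_pV2 ?posrE// ltr_nat.
exists (n.+1%:R^-1 - n.+2%:R^-1) => /=; first by rewrite subr_gt0.
move=> y xy z yz; apply: xW; have := ball_triangle xy yz.
by rewrite subrK.
Qed.

Lemma nondecreasing_inner_core W : {homo inner_core W : m n / (m <= n)%N >-> m `<=` n}.
Proof.
move=> m n /subnK <-; elim: (n - m)%N => // p IH.
apply: (subset_trans IH); rewrite addSn.
by move=> x /inner_core_interior /interior_subset.
Qed.

Lemma open_inner_core W : open W -> W = \bigcup_n inner_core W n.
Proof.
move=> oW; apply/seteqP; split => [x Wx|x [n _]]; last exact: inner_core_sub.
have /nbhs_ballP[e /= e0 He] : nbhs x W by apply: open_nbhs_nbhs.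
have [N _ /(_ N (leqnn N)) Ne] := near_infty_natSinv_lt (PosNum e0).
exists N => //; apply: subset_trans He; exact/le_ball/ltW.
Qed.

(** Around a point of [K i], half of a radius avoiding the other sets is used:
    if two such balls met, the larger full radius would reach the other centre. *)
Lemma closed_separation (I : finType) (K : I -> set T) :
  (forall i, closed (K i)) -> (forall i j, i != j -> K i `&` K j = set0) ->
  exists V : I -> set T, [/\ forall i, open (V i), forall i, K i `<=` V i &
    forall i j, i != j -> V i `&` V j = set0].
Proof.
move=> cK dK.
pose V i := \bigcup_(p in [set p : T * R | [/\ K i p.1, 0 < p.2 &
   forall j, j != i -> ball p.1 p.2 `&` K j = set0]]) ball p.1 (p.2 / 2).
exists V; split=> [i|i x Kx|].
- by apply: bigcup_open => p _; exact: ball_open.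
- have [|e /= e0 He] := (@nbhs_ballP _ _ x (\bigcap_(j in [set j | j != i]) ~` K j)).1.
    rewrite /bigcap; apply: filter_forall => j; have [->|ji] := eqVneq j i.
      by apply: nearW => y /=; rewrite eqxx.
    near=> y => _; near: y; apply: open_nbhs_nbhs; split; first exact: closed_openC.
    by move=> Kjx; have := dK _ _ ji; rewrite -subset0; apply; split; eassumption.
  exists (x, e); last by apply: ballxx; rewrite divr_gt0.
  split=> // j ji; rewrite -subset0 => y /= [/He /(_ j ji)] //.
- move=> i j ij; rewrite -subset0 => z [[[x e] /= [Kx e0 xd] xz]] [[y r] /= [Ky r0 yd] yz].
  have xy s : e <= s -> r <= s -> ball x s y.
    move=> es rs; have := ball_triangle xz (ball_sym yz).
    by apply: le_ball; lra.
  have [er|re] := leP e r.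
    have := yd i ij; rewrite -subset0; apply; split; last exact: Kx.
    by apply/ball_sym/xy.
  have := xd j; rewrite eq_sym -subset0; apply => //; split; last exact: Ky.
  by apply: xy => //; exact: ltW.
Unshelve. all: by end_near. Qed.

End metric_topology.

(** * A soft threshold of class C^1 *)

Section soft_threshold.
Context {R : realType}.
Implicit Types (e t h s : R).

Definition pos_part s : R := Num.max 0 s.

(** An odd function, zero for [|t| <= e], whose slope grows linearly from 0 to 1
    for [e <= |t| <= 2e], and equal to [t - 3e/2] for [t >= 2e]. *)
Definition soft e t : R :=
  (pos_part (t - e) ^+ 2 - pos_part (t - 2 * e) ^+ 2
   - pos_part (- t - e) ^+ 2 + pos_part (- t - 2 * e) ^+ 2) / (2 * e).

Definition dsoft e t : R :=
  (pos_part (t - e) - pos_part (t - 2 * e)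
   + pos_part (- t - e) - pos_part (- t - 2 * e)) / e.

(** The square of the positive part is convex and its derivative is
    2-Lipschitz. *)
Lemma pos_part_expand s t :
  0 <= pos_part t ^+ 2 - pos_part s ^+ 2 - 2 * pos_part s * (t - s) <= (t - s) ^+ 2.
Proof.
rewrite /pos_part; have [s0|s0] := leP s 0; have [t0|t0] := leP t 0;
  rewrite ?expr2; have := sqr_ge0 (t - s); rewrite expr2 => ?; apply/andP; split; nra.
Qed.

Lemma soft_expand e s t : 0 < e ->
  `|soft e t - soft e s - dsoft e s * (t - s)| <= e^-1 * (t - s) ^+ 2.
Proof.
move=> e0.
have := pos_part_expand (s - e) (t - e).
have := pos_part_expand (s - 2 * e) (t - 2 * e).
have := pos_part_expand (- s - e) (- t - e).
have := pos_part_expand (- s - 2 * e) (- t - 2 * e).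
rewrite /soft /dsoft.
set p1 := pos_part (s - e); set p2 := pos_part (s - 2 * e).
set p3 := pos_part (- s - e); set p4 := pos_part (- s - 2 * e).
set q1 := pos_part (t - e); set q2 := pos_part (t - 2 * e).
set q3 := pos_part (- t - e); set q4 := pos_part (- t - 2 * e).
clearbody p1 p2 p3 p4 q1 q2 q3 q4 => h4 h3 h2 h1.
have -> : (q1 ^+ 2 - q2 ^+ 2 - q3 ^+ 2 + q4 ^+ 2) / (2 * e) -
    (p1 ^+ 2 - p2 ^+ 2 - p3 ^+ 2 + p4 ^+ 2) / (2 * e) -
    (p1 - p2 + p3 - p4) / e * (t - s) =
    e^-1 * ((q1 ^+ 2 - q2 ^+ 2 - q3 ^+ 2 + q4 ^+ 2
     - (p1 ^+ 2 - p2 ^+ 2 - p3 ^+ 2 + p4 ^+ 2)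
     - 2 * (p1 - p2 + p3 - p4) * (t - s)) / 2) by field; rewrite gt_eqF.
have e1 : 0 < e^-1 by rewrite invr_gt0.
rewrite normrM (gtr0_norm e1) ler_pM2l// ler_norml; lra.
Qed.

(** A quadratic Taylor bound treats the kinks of piecewise quadratic functions
    without a case analysis. *)
Lemma is_derive_quadratic (f : R -> R) (df s C : R) :
  (forall t, `|f t - f s - df * (t - s)| <= C * (t - s) ^+ 2) -> is_derive s 1 f df.
Proof.
move=> fC; have C0 : 0 <= C.
  by have := le_trans (normr_ge0 _) (fC (s + 1)); rewrite addrAC subrr add0r expr1n mulr1.
have cvgf : (fun h => h^-1 *: ((f \o shift s) (h *: 1) - f s)) @ 0^' --> df.
  apply/cvgrPdist_le => e e0; rewrite near_withinE.
  near=> h => h0.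
  rewrite /= /shift /= [h *: 1]mulr1 -[_ *: _]/(_ * _).
  have := fC (h + s); rewrite addrK => fh.
  have -> : df - h^-1 * (f (h + s) - f s) = - (h^-1 * (f (h + s) - f s - df * h)).
    by field.
  rewrite normrN normrM normfV ler_pdivrMl ?normr_gt0//.
  apply: (le_trans fh); rewrite -(real_normK (num_real h)) expr2 mulrCA.
  rewrite ler_pM2l ?normr_gt0//.
  have : `|h| <= e / (C + 1).
    near: h; apply/nbhs_ballP; exists (e / (C + 1)) => [|h].
      by rewrite /= divr_gt0// ltr_wpDl.
    by rewrite /ball/= sub0r normrN => /ltW.
  rewrite ler_pdivlMr ?ltr_wpDl// => hC.
  by apply: le_trans hC; rewrite mulrDr mulr1 mulrC lerDl.
by apply: DeriveDef; [apply/cvg_ex; exists df|apply/cvg_lim].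
Unshelve. all: by end_near. Qed.

Lemma is_derive_soft e t : 0 < e -> is_derive t 1 (soft e) (dsoft e t).
Proof.
by move=> e0; apply: (@is_derive_quadratic _ _ _ e^-1) => s; exact: soft_expand.
Qed.

Lemma dsoft_bounds e t : 0 < e -> 0 <= dsoft e t <= 1.
Proof.
move=> e0; rewrite /dsoft divr_ge0 ?ler_pdivrMr ?mul1r ?(ltW e0)//=; last first.
  rewrite /pos_part; case: (leP (t - e) 0); case: (leP (t - 2 * e) 0);
  case: (leP (- t - e) 0); case: (leP (- t - 2 * e) 0); lra.
rewrite /pos_part; case: (leP (t - e) 0); case: (leP (t - 2 * e) 0);
  case: (leP (- t - e) 0); case: (leP (- t - 2 * e) 0); lra.
Qed.

Lemma soft_eq0 e t : 0 < e -> `|t| <= e -> soft e t = 0.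
Proof.
move=> e0; rewrite ler_norml => te; rewrite /soft /pos_part !max_l; lra.
Qed.

Lemma dsoft_eq0 e t : 0 < e -> `|t| <= e -> dsoft e t = 0.
Proof.
move=> e0; rewrite ler_norml => te; rewrite /dsoft /pos_part !max_l; lra.
Qed.

Lemma soft_approx e t : 0 < e -> `|soft e t - t| <= 2 * e.
Proof.
move=> e0; rewrite ler_norml /soft lerBrDr lerBlDr ler_pdivrMr ?ler_pdivlMr; try lra.
rewrite /pos_part; case: (leP (t - e) 0); case: (leP (t - 2 * e) 0);
  case: (leP (- t - e) 0); case: (leP (- t - 2 * e) 0); nra.
Qed.

Lemma continuous_dsoft e : continuous (dsoft e).
Proof.
have cp (f : R -> R) : continuous f -> continuous (fun t => pos_part (f t)).
  move=> cf s; apply: (@continuous_max _ _ (cst 0) f s); last exact: cf.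
  exact: cst_continuous.
have cS a : continuous (fun t : R => t - a).
  by move=> t; apply: cvgB => //; exact: cvg_cst.
have cN a : continuous (fun t : R => - t - a).
  by move=> t; apply: cvgB; [exact: cvgN|exact: cvg_cst].
move=> t; rewrite /dsoft; apply: cvgM; last exact: cvg_cst.
apply: cvgB; last exact: (cp _ (cN (2 * e))).
apply: cvgD; last exact: (cp _ (cN e)).
by apply: cvgB; [exact: (cp _ (cS e))|exact: (cp _ (cS (2 * e)))].
Qed.

End soft_threshold.

(** * Truncation of functions vanishing on the boundary *)

Section compact_superlevel.
Context {R : realType} {T : topologicalType}.
Implicit Types (K : set T) (g : T -> R).

Lemma compact_superlevel K g (t : R) : compact K -> closed K ->
  (forall x, K x -> {for x, continuous g}) ->
  compact (K `&` [set x | t <= g x]).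
Proof.
move=> cK clK cg; apply: (subclosed_compact _ cK); last exact: subIsetl.
move=> x xcl; have Kx : K x.
  by apply: clK => V /xcl[y [[Ky _] Vy]]; exists y.
split=> //=; rewrite leNgt; apply/negP => gx.
have /xcl[y [[_ /=]]] : nbhs x [set y | g y < t].
  have /(cg x Kx) : nbhs (g x) [set s | s < t]; last by [].
  by apply: open_nbhs_nbhs; split => //; exact: open_lt.
by rewrite leNgt => /negP; apply.
Qed.

Lemma continuous_compact_bounded K g : compact K ->
  (forall x, K x -> {for x, continuous g}) ->
  exists M, forall x, K x -> `|g x| <= M.
Proof.
move=> cK cg.
have [M [_ HM]] : bounded_set (g @` K).
  apply: compact_bounded; apply: continuous_compact => //.
  apply: continuous_in_subspaceT => x; rewrite inE; exact: cg.
exists (M + 1) => x Kx; apply: (HM (M + 1)); first by rewrite ltrDl.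
by exists x.
Qed.

End compact_superlevel.

(** Continuity is only available on [Omega], so measurability is proved through
    the preimages of open intervals, which are open because [Omega] is. *)
Lemma measurable_fun_continuousRV {R : realType} {d : nat} (Omega : set 'rV[R]_d)
    (g : 'rV[R]_d -> R) : open Omega ->
  (forall x, Omega x -> {for x, continuous g}) ->
  measurable_fun (Omega : set (borelRV R d)) (g : borelRV R d -> R).
Proof.
move=> oO cg mO; apply: (measurability _ (RGenOpens.measurableE R)) => //.
move=> _ [_ [x [y ->]] <-].
suff oV : @open 'rV[R]_d (Omega `&` [set v | `]x, y[%classic (g v)]).
  exact: measurable_openRV.
rewrite openE => z [Oz gz]; rewrite /interior /=; apply: filterI.
  exact: open_nbhs_nbhs.
have /(cg z Oz) : nbhs (g z) `]x, y[%classic; last by [].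
by apply: open_nbhs_nbhs; split => //; exact: itv_open.
Qed.

Section truncation.
Context {R : realType} {d : nat}.
Variable Omega : set 'rV[R]_d.
Hypotheses (oO : open Omega) (bO : bounded_set Omega).
Implicit Types (u v : 'rV[R]_d -> R).

Lemma C10_continuous u x : C10 Omega u -> Omega x -> {for x, continuous u}.
Proof. by move=> [du _ _] /du /differentiable_continuous. Qed.

(** Zero boundary values keep the superlevel sets away from the boundary. *)
Lemma compact_C10_superlevel u (e : R) : 0 < e -> C10 Omega u ->
  compact (Omega `&` [set x | e <= `|u x|]).
Proof.
move=> e0 uC; set K := _ `&` _.
apply: bounded_closed_compact.
  have [M [Mr MO]] := bO; exists M; split=> // s Ms x [Ox _]; exact: (MO s Ms x Ox).
have small x : nbhs x [set y | Omega y -> `|u y| < e] -> ~ closure K x.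
  by move=> Nx /(_ _ Nx)[y [[Oy /=]]]; rewrite leNgt => /negP ue /(_ Oy).
have near_small (l : R) : `|l| < e -> nbhs l [set y | `|y| < e].
  move=> le; apply/nbhs_ballP; exists (e - `|l|) => [|y]; first by rewrite /= subr_gt0.
  rewrite /ball/= => ly; have := ler_normD l (y - l); rewrite subrKC distrC.
  by move/le_lt_trans; apply; rewrite -ltrBrDl.
move=> x xK; have [Ox|nOx] := pselect (Omega x).
  split=> //=; rewrite leNgt; apply/negP => ux; apply: (small x) => //.
  have h := C10_continuous uC Ox (near_small _ ux).
  by apply: (@filterS _ (nbhs x) _ (u @^-1` [set y | `|y| < e])) h => y uy _; exact: uy.
exfalso; apply: (small x) => //.
have [_ _ /(_ x) u0] := uC.
have h0 : nbhs (0 : R) [set y | `|y| < e] by apply: near_small; rewrite normr0.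
have /u0 /(_ _ h0) // : (closure Omega `\` Omega) x.
by split=> //; apply: closureS xK; exact: subIsetl.
Qed.

Lemma pderiv_soft u (e : R) i x : 0 < e -> differentiable u x ->
  pderiv (soft e \o u) i x = dsoft e (u x) * pderiv u i x.
Proof.
move=> e0 du; have ds := is_derive_soft (u x) e0.
have dif : differentiable (soft e) (u x) by apply/derivable1_diffP; exact: ex_derive.
rewrite /pderiv !deriveE//; last exact: differentiable_comp.
rewrite diff_comp//= diff1E// derive1E (derive_val (is_derive:=ds)) mulrC //.
Qed.

Lemma continuous_sqnorm_grad u x : C10 Omega u -> Omega x ->
  {for x, continuous (sqnorm_grad u)}.
Proof.
move=> [_ cu _] Ox; rewrite /sqnorm_grad.
apply: cvg_big => [||i _]; [exact: add_continuous|exact: nbhs_filter|].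
by apply: continuousM; exact: cu.
Qed.

(** The truncation is [soft e] composed with [u].  By the chain rule its squared
    gradient is [dsoft e (u x) ^+ 2] times that of [u], and [dsoft] is between 0
    and 1 and vanishes where [|u| <= e], that is, off a compact subset of
    [Omega]. *)
Lemma C10_truncation u (e : R) : 0 < e -> C10 Omega u ->
  exists v, [/\ C10 Omega v, forall x, Omega x -> `|v x - u x| <= 2 * e,
    forall x, Omega x -> sqnorm_grad v x <= sqnorm_grad u x &
    exists K, [/\ compact K, K `<=` Omega &
      forall x, Omega x -> ~ K x -> sqnorm_grad v x = 0]].
Proof.
move=> e0 uC; have [du cu u0] := uC.
have dv x : Omega x -> differentiable (soft e \o u) x.
  move=> Ox; apply: differentiable_comp; first exact: du.
  by apply/derivable1_diffP; have := is_derive_soft (u x) e0 => ?; exact: ex_derive.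
have csoft t : {for t, continuous (soft e)}.
  apply: differentiable_continuous; apply/derivable1_diffP.
  by have := is_derive_soft t e0 => ?; exact: ex_derive.
have sqE x : Omega x -> sqnorm_grad (soft e \o u) x = dsoft e (u x) ^+ 2 * sqnorm_grad u x.
  move=> Ox; rewrite /sqnorm_grad mulr_sumr; apply: eq_bigr => i _.
  by rewrite pderiv_soft ?exprMn//; exact: du.
exists (soft e \o u); split.
- split=> [//|i x Ox|x xO].
  + suff : pderiv (soft e \o u) i y @[y --> x] --> pderiv (soft e \o u) i x by [].
    rewrite [X in _ --> X](pderiv_soft i e0 (du x Ox)).
    have : dsoft e (u y) * pderiv u i y @[y --> x] --> dsoft e (u x) * pderiv u i x.
      apply: (@cvgM R _ (nbhs x)); last exact: cu.
      exact: (cvg_comp _ _ (C10_continuous uC Ox) (@continuous_dsoft _ e (u x))).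
    have Ox' : nbhs x Omega by exact: open_nbhs_nbhs.
    have E : {near x, (fun y => dsoft e (u y) * pderiv u i y) =1 pderiv (soft e \o u) i}.
      apply: (@filterS _ (nbhs x) _ Omega) Ox' => y Oy.
      by rewrite pderiv_soft//; exact: du.
    by apply: cvg_trans; exact: near_eq_cvg E.
  + have s0 : soft e 0 = 0 by apply: soft_eq0 => //; rewrite normr0 ltW.
    rewrite -[X in _ --> X]s0.
    exact: (cvg_comp _ _ (u0 x xO) (csoft 0)).
- by move=> x _; exact: soft_approx.
- move=> x Ox; rewrite sqE// ler_piMl ?sumr_ge0//; first by move=> i _; exact: sqr_ge0.
  have /andP[d0 d1] := dsoft_bounds (u x) e0.
  by rewrite expr_le1.
- exists (Omega `&` [set x | e <= `|u x|]); split.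
  + exact: compact_C10_superlevel.
  + exact: subIsetl.
  + move=> x Ox nK; have ue : `|u x| <= e.
      by rewrite leNgt; apply/negP => /ltW ?; apply: nK.
    by rewrite sqE// dsoft_eq0// expr0n/= mul0r.
Qed.

Lemma C10_bounded u : C10 Omega u -> exists M, forall x, Omega x -> `|u x| <= M.
Proof.
move=> uC; have cK := compact_C10_superlevel ltr01 uC.
have [|M HM] := @continuous_compact_bounded R _ _ u cK.
  by move=> x [Ox _]; exact: C10_continuous uC Ox.
exists (Num.max M 1) => x Ox; rewrite le_max.
by have [u1|/ltW ->] := leP 1 `|u x|; rewrite ?orbT// HM.
Qed.

End truncation.

(** * Measures from finitely additive set functions *)

Lemma measurable_closedRV {R : realType} {d : nat} (C : set 'rV[R]_d) :
  closed C -> measurable (C : set (borelRV R d)).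
Proof.
move=> /closed_openC /measurable_openRV oC.
rewrite -(setCK (C : set (borelRV R d))).
exact: measurableC.
Qed.

Local Open Scope ereal_scope.

Section regularization.
Context {R : realType} {d : nat}.
Notation T := (borelRV R d).
Variable m : set T -> R.
Hypothesis m_ge0 : forall A, measurable A -> (0 <= m A)%R.
Hypothesis m_add : forall A B, measurable A -> measurable B ->
  A `&` B = set0 -> m (A `|` B) = (m A + m B)%R.
Implicit Types (A B : set T).

Let m0 : m set0 = 0%R.
Proof.
have := @m_add set0 set0 measurable0 measurable0 (setI0 _).
by rewrite setU0 => /eqP; rewrite addrC -subr_eq subrr => /eqP <-.
Qed.

Let m_diff A B : measurable A -> measurable B -> A `<=` B ->
  m (B `\` A) = (m B - m A)%R.
Proof.
move=> mA mB AB; rewrite -{2}(setDUK AB) m_add ?setDIK//; last exact: measurableD.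
by rewrite addrAC subrr add0r.
Qed.

Let le_m A B : measurable A -> measurable B -> A `<=` B -> (m A <= m B)%R.
Proof.
move=> mA mB AB; rewrite -subr_ge0 -m_diff//; apply: m_ge0.
exact: measurableD.
Qed.

Let m_subadd A B : measurable A -> measurable B -> (m (A `|` B) <= m A + m B)%R.
Proof.
move=> mA mB; rewrite -[A `|` B](setDUK (@subsetUl _ A B)) m_add ?setDIK//; last first.
  by apply: measurableD => //; exact: measurableU.
rewrite lerD2l; have UA : (A `|` B) `\` A `<=` B by move=> x [[|]].
by apply: le_m => //; apply: measurableD => //; exact: measurableU.
Qed.

Let le_bigm (F : nat -> set T) n : (forall i, measurable (F i)) ->
  (m (\big[setU/set0]_(i < n) F i) <= \sum_(i < n) m (F i))%R.
Proof.
move=> mF; elim: n => [|n IH]; first by rewrite !big_ord0 m0.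
rewrite !big_ord_recr/= (le_trans (m_subadd _ (mF _)))//.
  exact: bigsetU_measurable.
by rewrite lerD2r.
Qed.

(** The infinite value on the sets that are not open turns the covers by
    measurable sets of [mu_ext] into covers by open sets. *)
Definition open_weight A : \bar R :=
  if `[< @open 'rV[R]_d A >] then (m A)%:E else +oo.

Let open_weightE A : @open 'rV[R]_d A -> open_weight A = (m A)%:E.
Proof. by rewrite /open_weight; case: asboolP. Qed.

Let open_weight_ge0 A : 0 <= open_weight A.
Proof.
by rewrite /open_weight; case: asboolP => // /measurable_openRV mA; rewrite lee_fin m_ge0.
Qed.

Let open_weight0 : open_weight set0 = 0.
Proof. by rewrite open_weightE ?m0//; exact: open0. Qed.

Definition open_outer : set T -> \bar R := mu_ext open_weight.

HB.instance Definition _ := isOuterMeasure.Build R T open_outer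
  (mu_ext0 open_weight0 open_weight_ge0) (mu_ext_ge0 open_weight_ge0)
  (le_mu_ext open_weight) (mu_ext_sigma_subadditive open_weight_ge0).

Lemma open_outer_le A : open_outer A <= open_weight A.
Proof.
rewrite /open_weight; case: asboolP => oA; last by rewrite leey.
apply: ereal_inf_lbound; exists (fun n => if n is 0%N then A else set0).
  by split=> [[|_]|x Ax]; [exact: measurable_openRV|exact: measurable0|exists 0%N].
apply/cvg_lim => //; rewrite -cvg_shiftS.
rewrite (_ : [sequence _]_n = cst (m A)%:E); first exact: cvg_cst.
apply/funext => n /=; rewrite big_nat_recl//= big1 ?adde0 ?open_weightE// => i _.
by rewrite m0.
Qed.

Let open_outer_le_open (A : set T) (U : set 'rV[R]_d) : open U -> A `<=` U ->
  open_outer A <= (m U)%:E.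
Proof.
move=> oU AU; rewrite -open_weightE//; apply: le_trans (open_outer_le _).
exact: le_mu_ext.
Qed.

Let open_outer_cover A r : open_outer A < r ->
  exists F : nat -> set T, [/\ forall i, @open 'rV[R]_d (F i),
    A `<=` \bigcup_i F i & \sum_(i <oo) (m (F i))%:E < r].
Proof.
move=> /ereal_inf_lt[_ [F [mF AF] <-]] Fr; exists F.
have oF i : @open 'rV[R]_d (F i).
  apply: contrapT => nF; move: Fr.
  rewrite (eseries_pinfty _ _ (_ : open_weight (F i) = +oo)) ?ltNge ?leey//.
    by move=> n _; rewrite -ltNye (lt_le_trans _ (open_weight_ge0 _)).
  by rewrite /open_weight; case: asboolP.
split=> //; rewrite (eq_eseriesr (g := open_weight \o F))// => i _.
by rewrite /= open_weightE.
Qed.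

(** On a compact set countable covers reduce to finite ones, and [m] is finitely
    subadditive. *)
Lemma open_outer_compact (K : set 'rV[R]_d) (e : R) : compact K -> (0 < e)%R ->
  exists U : set 'rV[R]_d, [/\ open U, K `<=` U & (m U)%:E <= open_outer K + e%:E].
Proof.
move=> cK e0.
have Kfin : open_outer K \is a fin_num.
  rewrite ge0_fin_numE; last exact: mu_ext_ge0.
  apply: le_lt_trans (ltry (m setT)); apply: open_outer_le_open => //.
  exact: openT.
have /open_outer_cover[F [oF KF Fe]] : open_outer K < open_outer K + e%:E.
  by rewrite lteDl// lte_fin.
move: (cK); rewrite compact_cover => /(_ _ setT F (fun i _ => oF i) KF)[D _ KD].
pose N := (\max_(i <- finmap.enum_fset D) i).+1.
exists (\big[setU/set0]_(i < N) F i : set 'rV[R]_d); split.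
- by rewrite -bigcup_mkord; apply: bigcup_open => i _; exact: oF.
- move=> x /KD [i /= iD Fix]; rewrite -bigcup_mkord; exists i => //=.
  by rewrite /N ltnS; exact: (@leq_bigmax_seq _ _ xpredT id).
- apply: le_trans (ltW Fe).
  apply: (@le_trans _ _ (\sum_(0 <= i < N) (m (F i))%:E)).
    rewrite big_mkord sumEFin lee_fin; apply: le_bigm => i.
    by apply: measurable_openRV; exact: oF.
  apply: nneseries_lim_ge => i _ _; rewrite lee_fin; apply: m_ge0.
  by apply: measurable_openRV; exact: oF.
Qed.

(** The mass of the layers near the boundary telescopes. *)
Let open_outer_core (V : set 'rV[R]_d) (e : R) : open V -> (0 < e)%R ->
  exists n, open_outer (V `\` inner_core V n) <= e%:E.
Proof.
move=> oV e0; pose K : nat -> set T := inner_core V; pose s n := m (K n).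
have cK n : measurable (K n) by apply: measurable_closedRV; exact: closed_inner_core.
have ndK n p : (n <= p)%N -> K n `<=` K p by exact: nondecreasing_inner_core.
have nds : nondecreasing_seq s by move=> n p np; apply: le_m => //; exact: ndK.
have ubs : has_ubound (range s).
  by exists (m setT) => _ [n _ <-]; apply: le_m.
have hs : has_sup (range s) by split=> //; exists (s 0%N), 0%N.
have e2 : (0 < e / 2)%R by rewrite divr_gt0.
have [_ [n _ <-] sn] := sup_adherent e2 hs.
have {}sn N : (s N <= s n + e / 2)%R.
  rewrite -lerBlDr (le_trans _ (ltW sn))// lerD2r.
  by apply: ub_le_sup => //; exists N.
pose D j : set T := interior (inner_core V (n + j).+2) `\` K (n + j)%N.
have oD j : @open 'rV[R]_d (D j).
  apply: openI; first exact: open_interior.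
  by apply: closed_openC; exact: closed_inner_core.
have mDs j : (m (D j) <= s (n + j).+2 - s (n + j)%N)%R.
  rewrite -m_diff//; last exact/ndK/leqW/leqnSn.
  apply: le_m; [by apply: measurable_openRV; exact: oD|exact: measurableD|].
  by apply: setSD; exact: interior_subset.
have mDN N : (\sum_(0 <= j < N) m (D j) <= s (n + N).+1 + s (n + N)%N - s n.+1 - s n)%R.
  elim: N => [|N IH]; first by rewrite big_nil addn0; lra.
  by rewrite big_nat_recr//= addnS; have := mDs N; lra.
exists n; apply: (@le_trans _ _ (\sum_(j <oo) open_weight (D j))).
  apply: ereal_inf_lbound; exists D => //; split=> [i|x [Vx nx]].
    by apply: measurable_openRV; exact: oD.
  have xN : exists N, `[< K N x >].
    by move: Vx; rewrite {1}(open_inner_core oV) => -[N _ ?]; exists N; exact/asboolP.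
  case: (ex_minnP xN) => N /asboolP KNx minN.
  have nN : (n < N)%N by rewrite ltnNge; apply/negP => Nn; apply: nx; exact: (ndK _ _ Nn).
  have NE : N = (n + (N - n.+1)).+1 by rewrite -addSn subnKC.
  exists (N - n.+1)%N => //; split.
    by apply: inner_core_interior; rewrite -NE.
  move=> Kx; have := minN _ (asboolT Kx); by rewrite {1}NE ltnn.
(* The partial sums telescope to at most twice the gap between [s n] and
   the supremum of [s], hence the factor 1/2 in the choice of [n]. *)
apply: lime_le; first by apply: is_cvg_nneseries => j _ _.
apply: nearW => N; under eq_bigr do rewrite open_weightE//.
rewrite sumEFin lee_fin (le_trans (mDN N))//.
by have := sn (n + N).+1; have := sn (n + N)%N; have := nds n n.+1 (leqnSn _); lra.
Qed.

(** Caratheodory's inequality for [U] open: [U `&` W] is replaced, up to a small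
    error, by a closed subset, which has disjoint open neighbourhoods with the
    closed set [~` W]. *)
Let open_outer_split (U W : set 'rV[R]_d) : open U -> open W ->
  open_outer (U `&` W) + open_outer (U `&` ~` W) <= (m U)%:E.
Proof.
move=> oU oW; apply/lee_addgt0Pr => e e0.
have oUW : open (U `&` W) by exact: openI.
have [n Vn] := open_outer_core oUW e0.
set K := inner_core _ n in Vn.
have [|[] []//= _|V [oV KV dV]] := @closed_separation R 'rV[R]_d bool
  (fun b => if b then K else ~` W).
- by case; [exact: closed_inner_core|exact: open_closedC].
- by rewrite -subset0 => x [/inner_core_sub[]].
- by rewrite -subset0 => x [+ /inner_core_sub[]].
have oUV b : open (U `&` V b) by apply: openI.
have KU : open_outer K <= (m (U `&` V true))%:E.
  apply: open_outer_le_open => // x Kx; split; last exact: (KV true).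
  by have [] := inner_core_sub Kx.
have UU : open_outer (U `&` ~` W) <= (m (U `&` V false))%:E.
  by apply: open_outer_le_open => // x [Ux Wx]; split => //; exact: (KV false).
have VU : open_outer (U `&` W) <= open_outer K + e%:E.
  apply: le_trans (leeD2l _ Vn).
  rewrite -{1}(@setDUK _ K (U `&` W)) ?outer_measureU2//.
  exact: inner_core_sub.
apply: (le_trans (leeD VU UU)); rewrite addeAC leeD2r//.
apply: (le_trans (leeD KU (lexx _))); rewrite -EFinD lee_fin -m_add.
- apply: le_m; [|exact: measurable_openRV|by move=> x [[]|[]]].
  by apply: measurableU; apply: measurable_openRV.
- exact: measurable_openRV.
- exact: measurable_openRV.
- by rewrite setIACA dV// setI0.
Qed.

Lemma open_outer_caratheodory (W : set 'rV[R]_d) :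
  open W -> open_outer.-caratheodory W.
Proof.
move=> oW; apply: le_caratheodory_measurable => X /=.
apply: le_ereal_inf_tmp => _ [F [_ XF] <-].
have spl (B : set T) : open_outer (B `&` W) + open_outer (B `&` ~` W) <= open_weight B.
  rewrite /open_weight; case: asboolP => [oB|_]; last by rewrite leey.
  exact: open_outer_split.
have sub (B : set T) : open_outer (X `&` B) <= \sum_(i <oo) open_outer (F i `&` B).
  apply: le_trans (outer_measure_sigma_subadditive open_outer _).
  by apply: le_outer_measure; rewrite -setI_bigcupl; exact: setSI.
apply: (le_trans (leeD (sub _) (sub _))).
rewrite -nneseriesD; try by move=> *; exact: outer_measure_ge0.
apply: lee_nneseries => i _ //.
by rewrite adde_ge0//; exact: outer_measure_ge0.
Qed.

(** A copy of [open_outer] to carry the measure structure for the Borel sets: the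
    measure that an outer measure canonically carries lives on its
    Caratheodory-measurable sets. *)
Definition open_reg (A : set T) : \bar R := open_outer A.

Let borel_caratheodory (A : set T) : measurable A -> open_outer.-caratheodory A.
Proof.
apply: smallest_sub; last by move=> U; exact: open_outer_caratheodory.
exact: (@sigma_algebra_measurable _ (caratheodory_type open_outer)).
Qed.

Let open_reg0 : open_reg set0 = 0. Proof. exact: outer_measure0. Qed.

Let open_reg_ge0 A : 0 <= open_reg A. Proof. exact: outer_measure_ge0. Qed.

Let open_reg_sigma_additive : semi_sigma_additive open_reg.
Proof.
move=> F mF tF mUF.
apply: (@caratheodory_measure_sigma_additive _ _ open_outer) => // *;
  exact: borel_caratheodory.
Qed.

HB.instance Definition _ := isMeasure.Build _ T R open_reg
  open_reg0 open_reg_ge0 open_reg_sigma_additive.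

Let open_reg_fin : fin_num_fun open_reg.
Proof.
move=> A mA; rewrite ge0_fin_numE// (le_lt_trans _ (ltry (m setT)))//.
by apply: open_outer_le_open => //; exact: openT.
Qed.

HB.instance Definition _ := @Measure_isFinite.Build _ T R open_reg open_reg_fin.

(** The two inequalities characterize the measure that integrates continuous
    functions of compact support like [m]. *)
Lemma outer_regularization : exists mu : {finite_measure set T -> \bar R},
  (forall U : set 'rV[R]_d, open U -> mu U <= (m U)%:E) /\
  (forall (K : set 'rV[R]_d) (e : R), compact K -> (0 < e)%R ->
    exists U : set 'rV[R]_d, [/\ open U, K `<=` U & (m U)%:E <= mu K + e%:E]).
Proof.
exists open_reg; split=> [U oU|K e cK e0]; first exact: open_outer_le_open.
exact: open_outer_compact.
Qed.

End regularization.

(** * Limits of bounded sequences of measures *)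

(** A cluster point is a limit: for a neighbourhood [N] of it, the ultrafilter
    contains the preimage of [N] or that of its complement, and the latter is
    excluded. *)
Lemma ultrafilter_bounded_cvg (R : realType) (I : Type) (G : set_system I)
    (x : I -> R) (M : R) : UltraFilter G ->
  (forall i, `|x i| <= M)%R -> exists l : R, x i @[i --> G] --> l.
Proof.
move=> GU xM.
have xI : (x @ G) `[(- M)%R, M]%classic.
  by apply: nearW => i /=; rewrite in_itv/= -ler_norml.
have [l [_ lc]] := @segment_compact _ (- M) M _ _ xI.
exists l => N /= Nl.
have [//|GN] := in_ultra_setVsetC (x @^-1` N) GU.
by have [z [] ] := lc (~` N) N GN Nl.
Qed.

(** A limit along an ultrafilter exists on all Borel sets at once, without
    extracting subsequences, and is finitely additive since limits commute with
    sums. *)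
Lemma weak_compactness (R : realType) (d : nat)
    (a : nat -> {finite_measure set (borelRV R d) -> \bar R}) (M : R) :
  (forall n, a n setT <= M%:E) ->
  exists (G : set_system nat) (m : set (borelRV R d) -> R)
    (mu : {finite_measure set (borelRV R d) -> \bar R}),
  [/\ ProperFilter G, \oo%classic `<=` G,
    forall A, measurable A -> fine (a n A) @[n --> G] --> m A,
    forall U : set 'rV[R]_d, open U -> mu U <= (m U)%:E &
    forall (K : set 'rV[R]_d) (e : R), compact K -> (0 < e)%R ->
    exists U : set 'rV[R]_d, [/\ open U, K `<=` U & (m U)%:E <= mu K + e%:E] ].
Proof.
move=> aM; have [G [GU ooG]] := @ultraFilterLemma nat \oo _.
pose m A := lim (fine (a n A) @[n --> G]).
have mcvg A : measurable A -> fine (a n A) @[n --> G] --> m A.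
  move=> mA; apply/cvg_ex; apply: (@ultrafilter_bounded_cvg _ _ _ _ M) => n.
  rewrite ger0_norm ?fine_ge0// -lee_fin fineK ?fin_num_measure//.
  apply: le_trans (aM n); apply: le_measure; rewrite ?inE//.
have m_ge0 A : measurable A -> (0 <= m A)%R.
  move=> mA; apply: limr_ge; first by apply/cvg_ex; exists (m A); exact: mcvg.
  by apply: nearW => n; rewrite fine_ge0.
have m_add A B : measurable A -> measurable B -> A `&` B = set0 ->
    m (A `|` B) = (m A + m B)%R.
  move=> mA mB AB; apply/cvg_lim => //.
  rewrite (_ : (fun n => _) = (fun n => fine (a n A) + fine (a n B))%R).
    by apply: cvgD; exact: mcvg.
  by apply/funext => n; rewrite measureU// fineD ?fin_num_measure.
have [mu [muU muK]] := outer_regularization m_ge0 m_add.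
exists G, m, mu; split=> //; exact: ultra_proper.
Qed.

(** * Regularity of finite Borel measures *)

Section regularity.
Context {R : realType} {d : nat}.
Notation T := (borelRV R d).
Variable nu : {finite_measure set T -> \bar R}.

(** Squeezing between a closed and an open set is stable under complements,
    which makes these sets a sigma-algebra. *)
Let approx (A : set T) := forall e : R, (0 < e)%R ->
  exists C U : set 'rV[R]_d, [/\ closed C, open U, C `<=` A, A `<=` U &
    nu (U `\` C) <= e%:E].

Let cvg0_small (B : nat -> set T) : (forall n, measurable (B n)) ->
  {homo B : m n / (m <= n)%N >-> (n <= m)%O} ->
  forall e : R, (0 < e)%R -> exists n, nu (B n) <= nu (\bigcap_n B n) + e%:E.
Proof.
move=> mB niB e e0.
have mI : measurable (\bigcap_n B n) by exact: bigcap_measurable.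
have fI : nu (\bigcap_n B n) \is a fin_num by exact: fin_num_measure.
have := @nonincreasing_cvg_mu _ _ _ nu B _ mB mI niB.
rewrite ltey_eq fin_num_measure// => /(_ isT).
rewrite -[X in _ --> X]fineK// => /fine_cvgP[_ /cvgrPdist_le/(_ _ e0)[n _ /(_ n (leqnn n))]] /=.
rewrite ler_distlC => /andP[_ h]; exists n.
by rewrite -[nu (B n)]fineK ?fin_num_measure// -[X in _ <= X + _]fineK// -EFinD lee_fin.
Qed.

Let approx_open (W : set 'rV[R]_d) : open W -> approx W.
Proof.
move=> oW e e0.
have [||n Wn] := @cvg0_small (fun n => W `\` inner_core W n) _ _ _ e0.
- move=> n; apply: measurableD; first exact: measurable_openRV.
  by apply: measurable_closedRV; exact: closed_inner_core.
- by move=> m n mn; apply/subsetPset; apply: setDS; exact: nondecreasing_inner_core.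
exists (inner_core W n), W; split=> //; first exact: closed_inner_core.
  exact: inner_core_sub.
apply: (le_trans Wn); rewrite (_ : \bigcap_n _ = set0) ?measure0 ?add0e//.
rewrite -subset0 => x h; have [+ _] := h 0%N I.
by rewrite {1}(open_inner_core oW) => -[n' _ /(proj2 (h n' I))].
Qed.

Let approx_bigcup (A : nat -> set T) : (forall n, approx (A n)) ->
  approx (\bigcup_n A n).
Proof.
move=> aA e e0.
have e2 : (0 < e / 2)%R by rewrite divr_gt0.
have /choice[CU CUP] n : exists p : set 'rV[R]_d * set 'rV[R]_d,
    [/\ closed p.1, open p.2, p.1 `<=` A n, A n `<=` p.2 &
    nu (p.2 `\` p.1) <= (e / 2 / (2 ^ n.+1)%:R)%:E].
  have [|C [U h]] := aA n (e / 2 / (2 ^ n.+1)%:R)%R; last by exists (C, U).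
  by rewrite divr_gt0// ltr0n expn_gt0.
pose C n : set T := (CU n).1; pose U n : set T := (CU n).2.
have mC n : measurable (C n) by apply: measurable_closedRV; have [] := CUP n.
have mU n : measurable (U n) by apply: measurable_openRV; have [] := CUP n.
have mUU : measurable (\bigcup_n U n) by exact: bigcup_measurable.
pose B n := \bigcup_n U n `\` \big[setU/set0]_(i < n) C i.
have [||n Bn] := @cvg0_small B _ _ _ e2.
- by move=> n; apply: measurableD => //; exact: bigsetU_measurable.
- by move=> m n mn; apply/subsetPset; apply: setDS; exact: subset_bigsetU.
(* A finite union of closed sets is closed, a countable one need not be: one
   half of [e] pays for the approximations, the other for stopping at [n]. *)
have BU : nu (\bigcap_n B n) <= (e / 2)%:E.
  apply: (@le_trans _ _ (\sum_(n <oo) nu (U n `\` C n))).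
    apply: measure_sigma_subadditive.
    - by move=> k; exact: measurableD.
    - apply: bigcap_measurable => // k _; apply: measurableD => //.
      exact: bigsetU_measurable.
    - move=> x Bx; have [[k _ Ukx] _] := Bx 0%N I; exists k => //; split=> // Ckx.
      by have [_ []] := Bx k.+1 I; rewrite big_ord_recr; right.
  apply: le_trans (epsilon_trick0 _ (ltW e2)) => //.
  by apply: lee_nneseries => // k _; have [] := CUP k.
exists (\big[setU/set0]_(i < n) C i : set 'rV[R]_d), (\bigcup_n U n); split.
- by apply: closed_bigsetU => i _; have [] := CUP i.
- by apply: bigcup_open => i _; have [] := CUP i.
- rewrite -bigcup_mkord => x [i _ Cx]; exists i => //.
  by have [_ _ CA _ _] := CUP i; exact: CA.
- by apply: subset_bigcup => i _; have [] := CUP i.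
- apply: (le_trans Bn); rewrite [leRHS](_ : _ = (e / 2)%:E + (e / 2)%:E) ?leeD2r//.
  by rewrite -EFinD -splitr.
Qed.

Let borel_approx (A : set T) : measurable A -> approx A.
Proof.
apply: smallest_sub; last exact: approx_open.
split.
- move=> e e0; exists set0, set0; split=> //; first exact: closed0.
  by rewrite setDv measure0 lee_fin ltW.
- move=> B aB e e0; have [C [U [cC oU CB BU h]]] := aB e e0.
  exists (~` U), (~` C); rewrite setTD; split.
  + exact: open_closedC.
  + exact: closed_openC.
  + exact: subsetC.
  + exact: subsetC.
  + by rewrite setDE setCK setIC -setDE.
- exact: approx_bigcup.
Qed.

Lemma closed_inner_regular (A : set T) (e : R) : measurable A -> (0 < e)%R ->
  exists C : set 'rV[R]_d, [/\ closed C, C `<=` A & nu A <= nu C + e%:E].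
Proof.
move=> mA e0; have [C [U [cC oU CA AU h]]] := borel_approx mA e0.
exists C; split=> //; have mC := measurable_closedRV cC.
rewrite -{1}(setDUK CA) measureU//; [|exact: measurableD|exact: setDIK].
rewrite leeD2l//; apply: le_trans h; apply: le_measure; rewrite ?inE//.
- exact: measurableD.
- by apply: measurableD => //; exact: measurable_openRV.
- exact: setSD.
Qed.

Lemma open_outer_regular (A : set T) (e : R) : measurable A -> (0 < e)%R ->
  exists U : set 'rV[R]_d, [/\ open U, A `<=` U & nu U <= nu A + e%:E].
Proof.
move=> mA e0; have [C [U [cC oU CA AU h]]] := borel_approx mA e0.
exists U; split=> //; have mU := measurable_openRV oU.
rewrite -{1}(setDUK AU) measureU//; [|exact: measurableD|exact: setDIK].
rewrite leeD2l//; apply: le_trans h; apply: le_measure; rewrite ?inE//.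
- exact: measurableD.
- by apply: measurableD => //; exact: measurable_closedRV.
- exact: setDS.
Qed.

End regularity.

(** * Affine minorants of a convex function of linear growth *)

Section affine_minorants.
Context {R : realType}.
Variables (psi : R -> \bar R) (k : R).
Hypotheses (psi_ge0 : nneg_valued psi) (psi_convex : convex_on_nneg psi)
  (psi_lsc : lsc_on_nneg psi) (psi_growth : linear_growth psi k).

Definition affine_minorant (l : R * R) :=
  forall s : R, (0 <= s)%R -> (l.1 * s + l.2)%:E <= psi s.

Lemma affine_minorant0 : affine_minorant (0, 0)%R.
Proof. by move=> s s0; rewrite mul0r addr0; exact: psi_ge0. Qed.

Lemma growth_near (U : set (\bar R)) : nbhs k%:E U ->
  exists s0 : R, (0 < s0)%R /\ forall s, (s0 <= s)%R -> U (psi s * (s^-1)%:E).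
Proof.
move=> /psi_growth [M [Mr MU]]; exists (Num.max 1 (M + 1))%R.
split=> [|s]; first by rewrite lt_max ltr01.
by rewrite ge_max => /andP[_ Ms]; apply: MU; rewrite (lt_le_trans _ Ms)// ltrDl.
Qed.

Lemma growth_ge (al : R) : (al < k)%R -> exists s0 : R, (0 < s0)%R /\
  forall s, (s0 <= s)%R -> (al * s)%:E <= psi s.
Proof.
move=> alk; have [|s0 [s00 h]] := @growth_near [set x | al%:E < x].
  by apply: open_nbhs_nbhs; split; [exact: open_ereal_gt_ereal|rewrite /= lte_fin].
exists s0; split=> // s ss0; have s_gt0 := lt_le_trans s00 ss0.
have := ltW (h _ ss0); rewrite -(lee_pmul2r _ (_ : 0 < s%:E))//.
by rewrite -muleA -!EFinM mulVf ?gt_eqF// mule1.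
Qed.

Lemma growth_lty : exists s0 : R, (0 < s0)%R /\
  forall s, (s0 <= s)%R -> psi s < +oo.
Proof.
have [|s0 [s00 h]] := @growth_near [set x | x < (k + 1)%:E].
  apply: open_nbhs_nbhs; split; first exact: open_ereal_lt_ereal.
  by rewrite /= lte_fin ltrDl.
exists s0; split=> // s ss0; have s_gt0 := lt_le_trans s00 ss0.
have := h _ ss0; rewrite /= ltey; apply: contraTneq => ->.
by rewrite gt0_mulye ?lte_fin ?invr_gt0// ltNge leey.
Qed.

(** Beyond some [s0] the line of slope [al] through the origin is below [psi];
    lowering it by [|al| * s0] makes it nonpositive before [s0]. *)
Lemma affine_minorant_slope (al : R) : (al < k)%R ->
  exists be : R, affine_minorant (al, be).
Proof.
move=> /growth_ge[s0 [s00 h]]; exists (- (`|al| * s0))%R => s s_ge0 /=.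
have [ss0|ss0] := leP s0 s.
  apply: le_trans (h _ ss0); rewrite lee_fin gerDl oppr_le0 mulr_ge0//.
  exact: ltW.
apply: le_trans (psi_ge0 s_ge0); rewrite lee_fin subr_le0.
apply: (@le_trans _ _ (`|al| * s)%R); first by rewrite ler_wpM2r// ler_norm.
by rewrite ler_wpM2l// ltW.
Qed.

Lemma affine_minorant_slope_le (l : R * R) : affine_minorant l -> (l.1 <= k)%R.
Proof.
case: l => al be /= h; rewrite leNgt; apply/negP => kal.
have [|s0 [s00 {}hk]] := @growth_near [set x | x < ((k + al) / 2)%:E].
  apply: open_nbhs_nbhs; split; first exact: open_ereal_lt_ereal.
  by rewrite /= lte_fin; lra.
have e0 : (0 < al - k)%R by rewrite subr_gt0.
have [s [ss0 hs]] : exists s, (s0 <= s)%R /\ (2 * `|be| <= (al - k) * s)%R.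
  exists (s0 + 2 * `|be| / (al - k))%R; split.
    by rewrite lerDl divr_ge0 ?mulr_ge0// ltW.
  rewrite mulrDr [X in (_ <= _ + X)%R]mulrC divfK ?gt_eqF// lerDr.
  by rewrite mulr_ge0// ltW.
have s_gt0 := lt_le_trans s00 ss0.
have /= := hk _ ss0; rewrite -(lte_pmul2r _ (_ : 0 < s%:E))//.
rewrite -muleA -!EFinM mulVf ?gt_eqF// mule1 => /(le_lt_trans (h _ (ltW s_gt0))).
rewrite lte_fin ltNge => /negP; apply => /=.
have := ler_norm (- be)%R; rewrite normrN; nra.
Qed.

(** A line through a point strictly below the graph.  Its slope is the infimum
    of the slopes [(psi t - r) / (t - s)] over [t > s] in the domain of
    [psi], which is finite by lower
    semicontinuity near [s] and nonnegativity of [psi] elsewhere; convexity gives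
    the inequality on the left of [s]. *)
Lemma affine_minorant_through (s r : R) : (0 <= s)%R -> r%:E < psi s ->
  exists l, affine_minorant l /\ (l.1 * s + l.2 = r)%R.
Proof.
move=> s_ge0 rs.
have [e /= e0 He] := (@nbhs_ballP _ _ _ _).1 (psi_lsc s_ge0 rs).
have [t0 [t0_gt0 t0y]] := growth_lty.
pose E := [set ((fine (psi t) - r) / (t - s))%R | t in
   [set t | (s < t)%R /\ psi t < +oo]].
have E0 : E !=set0.
  exists ((fine (psi (t0 + s + 1)) - r) / (t0 + s + 1 - s))%R, (t0 + s + 1)%R => //=.
  by split; [lra|apply: t0y; lra].
have fpsi (t : R) : (0 <= t)%R -> psi t < +oo -> psi t = (fine (psi t))%:E.
  by move=> t0' ty; rewrite fineK// ge0_fin_numE// psi_ge0.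
(* For [t - s < e] the chord slope is nonnegative since [r < psi t]; further
   away it is at least [- r / (t - s)]. *)
have lbE : lbound E (- (`|r| / e))%R.
  move=> _ [t [st ty] <-].
  have t_ge0 : (0 <= t)%R by exact: ltW (le_lt_trans s_ge0 st).
  have ts : (0 < t - s)%R by rewrite subr_gt0.
  rewrite ler_pdivlMr//.
  have [te|te] := ltP (t - s)%R e.
    have : r%:E < psi t.
      by apply: He => //; rewrite /ball/= distrC ger0_norm// ltW.
    rewrite (fpsi t)// lte_fin => rt.
    apply: (@le_trans _ _ 0%R); last by rewrite subr_ge0 ltW.
    by rewrite mulNr oppr_le0 !mulr_ge0 ?invr_ge0 ?(ltW e0) ?(ltW ts).
  apply: (@le_trans _ _ (- `|r|)%R).
    by rewrite mulNr lerN2 -mulrA ler_peMr// mulrC ler_pdivlMr// mul1r.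
  have : (0 <= fine (psi t))%R by rewrite fine_ge0// psi_ge0.
  by have := ler_norm r; lra.
have hE : has_inf E by split=> //; exists (- (`|r| / e))%R.
exists (inf E, r - inf E * s)%R; split; last by rewrite /=; lra.
move=> t t_ge0 /=; have [ty|] := ltP (psi t) +oo; last first.
  by rewrite leye_eq => /eqP ->; rewrite leey.
rewrite (fpsi t)// lee_fin; have [ts|st|ts] := ltgtP t s; last 2 first.
- have : (inf E <= (fine (psi t) - r) / (t - s))%R by apply: ge_inf; [exact: hE.2|exists t].
  by rewrite ler_pdivlMr ?subr_gt0//; lra.
- by subst t; move: rs; rewrite (fpsi s)// lte_fin => /ltW; lra.
have st0 : (0 < s - t)%R by rewrite subr_gt0.
have : ((r - fine (psi t)) / (s - t) <= inf E)%R.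
  apply: lb_le_inf => // _ [t2 [st2 ty2] <-].
  have t2s : (0 < t2 - s)%R by rewrite subr_gt0.
  have t2t : (0 < t2 - t)%R by lra.
  have t2_ge0 : (0 <= t2)%R by lra.
  rewrite ler_pdivlMr// mulrAC ler_pdivrMr//.
  pose p := ((t2 - s) / (t2 - t))%R.
  have pE : (p * (t2 - t) = t2 - s)%R by rewrite /p divfK// gt_eqF.
  have p01 : (0 <= p <= 1)%R.
    by rewrite divr_ge0 ?(ltW t2s) ?(ltW t2t)//= ler_pdivrMr//; lra.
  have := psi_convex t_ge0 t2_ge0 p01.
  have -> : (p * t + (1 - p) * t2 = s)%R by move: pE; lra.
  rewrite (fpsi t)// (fpsi t2)// -!EFinM -EFinD => /(lt_le_trans rs).
  rewrite lte_fin; move: pE t2t; clearbody p => pE t2t h.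
  have : (r * (t2 - t) <= (t2 - s) * fine (psi t) + (s - t) * fine (psi t2))%R.
    rewrite (_ : (s - t = (1 - p) * (t2 - t))%R); last by lra.
    by rewrite -pE; nra.
  lra.
by rewrite ler_pdivrMr//; lra.
Qed.

(** On nonnegative reals, decreasing both coefficients keeps a minorant a
    minorant, so that rational coefficients suffice.  The zero function is put first to make
    the partial maxima nonnegative. *)
Lemma exists_minorant_sequence : exists l : nat -> R * R,
  [/\ l 0%N = (0, 0)%R, forall j, affine_minorant (l j) &
   forall s r : R, (0 <= s)%R -> r%:E < psi s ->
     exists j, (r < (l j).1 * s + (l j).2)%R].
Proof.
pose real (q : rat * rat) : R * R := (ratr q.1, ratr q.2).
pose l n : R * R := if n isn't n'.+1 then (0, 0)%R else
  if unpickle n' is Some q then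
    if `[< affine_minorant (real q) >] then real q else (0, 0)%R
  else (0, 0)%R.
exists l; split=> // [[|n]|s r s0 rs].
- exact: affine_minorant0.
- rewrite /l; case: unpickle => [q|]; last exact: affine_minorant0.
  by case: asboolP => // _; exact: affine_minorant0.
have [r' rr' rs'] : exists2 r', (r < r')%R & r'%:E < psi s.
  move: rs; case: (psi s) => [y| |//].
    by rewrite lte_fin => ry; exists ((r + y) / 2)%R; rewrite ?lte_fin; lra.
  by exists (r + 1)%R; rewrite ?ltrDl ?ltry.
have [[al be] [mab /= abr]] := affine_minorant_through s0 rs'.
pose e := ((r' - r) / (s + 1))%R.
have e0 : (0 < e)%R by rewrite divr_gt0//; lra.
have eE : (e * (s + 1) = r' - r)%R by rewrite /e divfK//; lra.
clearbody e.
have [|q1] := @rat_in_itvoo R (al - e)%R al; first by lra.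
have [|q2] := @rat_in_itvoo R (be - e)%R be; first by lra.
rewrite !in_itv/= => /andP[q2l q2r] /andP[q1l q1r].
exists (pickle (q1, q2)).+1; rewrite /l pickleK; case: asboolP => [_|[]] /=.
  by nra.
move=> t t0 /=; apply: le_trans (mab t t0); rewrite lee_fin /=; nra.
Qed.

End affine_minorants.

(** * Lebesgue decomposition *)

(** A null set whose [nu]-mass is the supremum over all null sets absorbs the
    part of [nu] that is singular with respect to [mu]. *)
Lemma maximal_null_set d (T : measurableType d) (R : realType)
    (mu : {measure set T -> \bar R}) (nu : {finite_measure set T -> \bar R}) :
  exists N : set T, [/\ measurable N, mu N = 0 &
    forall A, measurable A -> mu A = 0 -> nu (A `&` ~` N) = 0].
Proof.
pose S := [set fine (nu A) | A in [set A | measurable A /\ mu A = 0]].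
have hS : has_sup S.
  split; first by exists (fine (nu set0)), set0; rewrite ?measure0.
  exists (fine (nu setT)) => _ [A [mA _] <-].
  by rewrite fine_le ?fin_num_measure// le_measure ?inE.
have /choice[F FP] n : exists A, [/\ measurable A, mu A = 0 &
    (sup S - n.+1%:R^-1 < fine (nu A))%R].
  have n0 : (0 < n.+1%:R^-1 :> R)%R by rewrite invr_gt0.
  by have [_ [A [mA A0] <-] h] := sup_adherent n0 hS; exists A.
have mF n : measurable (F n) by have [] := FP n.
pose N := \bigcup_n F n.
have mN : measurable N by exact: bigcup_measurable.
have muN : mu N = 0.
  apply/eqP; rewrite eq_le measure_ge0 andbT.
  apply: le_trans (measure_sigma_subadditive mu _ mN _) _; [exact: mF|by []|].
  by rewrite eseries0// => n _ _; have [] := FP n.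
exists N; split=> // A mA muA.
have mAN : measurable (A `&` ~` N) by apply: measurableI => //; exact: measurableC.
have muAN : mu (A `&` ~` N) = 0.
  by apply/eqP; rewrite eq_le measure_ge0 andbT -muA le_measure ?inE//; exact: subIsetl.
have NS : (fine (nu (N `|` A `&` ~` N)) <= sup S)%R.
  apply: ub_le_sup; first exact: hS.2.
  exists (N `|` A `&` ~` N) => //; split; first exact: measurableU.
  rewrite /= measureU//; last by rewrite setICA setICr setI0.
  by rewrite [X in X + _]muN [X in _ + X]muAN adde0.
have SN : (sup S <= fine (nu N))%R.
  apply/ler_addgt0Pr => e e0.
  have [n _ /(_ n (leqnn n)) ne] := near_infty_natSinv_lt (PosNum e0).
  have [_ _] := FP n; rewrite ltrBlDr => /ltW /le_trans; apply.
  apply: lerD; last exact: ltW.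
  by rewrite fine_le ?fin_num_measure// le_measure ?inE//; exact: bigcup_sup.
move: NS; rewrite measureU//; last by rewrite setICA setICr setI0.
rewrite fineD ?fin_num_measure// => NS.
apply/eqP; rewrite eq_le measure_ge0 andbT -[X in X <= _]fineK ?fin_num_measure//.
by rewrite lee_fin; lra.
Qed.

(** The restriction of [a] to the complement of a maximal null set is absolutely
    continuous and has a density by the Radon-Nikodym theorem. *)
Lemma lebesgue_decomposition_exists (R : realType) (d : nat)
    (a : {finite_measure set (borelRV R d) -> \bar R}) :
  exists h s, lebesgue_decomposition a h s.
Proof.
have [N [mN N0 Nmax]] := maximal_null_set (lebesgueRV R d) a.
have mNC := measurableC mN.
have aNC : a (~` N) < +oo by rewrite ltey_eq fin_num_measure.
have aN : a N < +oo by rewrite ltey_eq fin_num_measure.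
pose ac := mfrestr mNC aNC.
have dom : ac `<< lebesgueRV R d.
  by apply/null_content_dominatesP => A mA A0; exact: Nmax.
have [g [g0 gfin gint gE]] := radon_nikodym_sigma_finite dom.
exists (fine \o g), (mfrestr mN aN); split.
- by apply: (measurableT_comp (fine_measurable _)) => //; exact: measurable_int gint.
- by move=> x /=; rewrite fine_ge0.
- exists N; split; [exact: mN|exact: N0|].
  by rewrite /= /mfrestr /mrestr setICl measure0.
- move=> A mA.
  rewrite (_ : \int[_]_(x in A) _ = ac A); last first.
    by rewrite [RHS]gE//; apply: eq_integral => x _; rewrite /= fineK.
  rewrite -{1}(setIT A) -(setUv N) setIUr measureU; last first.
  - by rewrite setIACA setICr setI0.
  - exact: measurableI.
  - exact: measurableI.
  by rewrite addeC.
Qed.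

Lemma lebesgueRV_box (R : realType) (d : nat) (M : R) :
  exists B : set (borelRV R d), [/\ measurable B,
    [set v : 'rV[R]_d | forall i, `|v 0%R i| <= M]%R `<=` B &
    lebesgueRV R d B < +oo].
Proof.
elim: d => [|d [B [mB BM Bfin]]].
  by exists setT; split=> //=; rewrite diracT ltry.
pose C : set (measurableTypeR R * borelRV R d) := `[(- M)%R, M]%classic `*` B.
have lebM : (@lebesgue_measure R) `[(- M)%R, M]%classic \is a fin_num.
  by rewrite lebesgue_measure_itv/=; case: ifP.
exists (@unconsRV R d @^-1` C); split.
- rewrite -[X in measurable X]setTI; apply: measurable_unconsRV => //.
  by apply: measurableX.
- move=> v vM; split => /=.
    by rewrite in_itv/= -ler_norml mxE.
  by apply: BM => i; rewrite mxE.
- rewrite /= /pushRV /pushforward -comp_preimage (_ : _ \o _ = id); last first.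
    by apply/funext => p /=; exact: consRVK.
  rewrite preimage_id product_measure1E// lte_mul_pinfty//.
Qed.

Lemma lebesgueRV_bounded (R : realType) (d : nat) (A : set 'rV[R]_d) :
  bounded_set A -> measurable (A : set (borelRV R d)) -> lebesgueRV R d A < +oo.
Proof.
move=> [M [Mr AM]] mA; have [B [mB BM Bfin]] := lebesgueRV_box d (M + 1)%R.
apply: le_lt_trans Bfin; apply: le_measure; rewrite ?inE// => v /AM vM.
apply: BM => i; apply: le_trans (vM (M + 1)%R _); last by rewrite ltrDl.
have /mapP[j Hj ->] : `|v ord0 i|%R \in [seq `|v x.1 x.2|%R | x : 'I_1 * 'I_d].
  by apply/mapP; exists (ord0, i) => //=; rewrite mem_enum.
by rewrite [leRHS]/Num.norm /= mx_normrE; apply/bigmax_geP; right => /=; exists j.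
Qed.

(** * Layer-cake bounds *)

Section layer_cake.
Context d (T : measurableType d) (R : realType).
Variables (a : {finite_measure set T -> \bar R}) (D : set T) (mD : measurable D).
Variables (g : T -> R) (e : R).
Hypotheses (mg : measurable_fun D g) (g_ge0 : forall x, D x -> (0 <= g x)%R)
  (e_gt0 : (0 < e)%R).

Definition layer (i : nat) := D `&` [set x | i.+1%:R * e <= g x]%R.

Lemma measurable_layer i : measurable (layer i).
Proof.
rewrite (_ : layer i = D `&` g @^-1` `[(i.+1%:R * e)%R, +oo[%classic).
  by apply: mg => //; exact: measurable_itv.
by apply/seteqP; split=> x [Dx] /=; rewrite in_itv/= andbT.
Qed.

Let step (n : nat) (x : T) : R := (\sum_(i < n) e * \1_(layer i) x)%R.

Let indic_layer i x : D x -> \1_(layer i) x = (i.+1%:R * e <= g x)%R%:R :> R.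
Proof.
move=> Dx; rewrite indicE; congr (_%:R); congr nat_of_bool.
by apply/idP/idP => [|gx]; rewrite inE; [case|split].
Qed.

Let step_le n x : D x -> (step n x <= g x)%R /\ (step n x <= n%:R * e)%R.
Proof.
move=> Dx; elim: n => [|n [IH1 IH2]].
  by rewrite /step big_ord0 mul0r; split=> //; exact: g_ge0.
rewrite /step big_ord_recr/= -/(step n x) indic_layer// -natr1 mulrDl mul1r.
case: (leP (n%:R * e + e)%R (g x)) => h; rewrite /= ?mulr1n ?mulr0n ?mulr1 ?mulr0; split; lra.
Qed.

Let step_ge n x : D x -> (g x <= step n x + e \/ n%:R * e <= step n x)%R.
Proof.
move=> Dx; elim: n => [|n IH].
  by right; rewrite /step big_ord0 mul0r.
rewrite /step big_ord_recr/= -/(step n x) indic_layer// -natr1 mulrDl mul1r.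
have [_ sn] := step_le n Dx.
by case: (leP (n%:R * e + e)%R (g x)) => h; rewrite /= ?mulr1n ?mulr0n ?mulr1 ?mulr0;
  case: IH => IH; [right|right|left|left]; lra.
Qed.

Let integral_step n : \int[a]_(x in D) (step n x)%:E =
  (e * \sum_(i < n) fine (a (layer i)))%:E.
Proof.
rewrite /step; under eq_integral do rewrite -sumEFin.
rewrite ge0_integral_sum//; last 2 first.
- move=> i; apply/measurable_EFinP; apply: measurable_funM => //.
  by apply: measurable_indic; exact: measurable_layer.
- by move=> i x _; rewrite lee_fin mulr_ge0// ltW.
rewrite mulr_sumr -sumEFin; apply: eq_bigr => i _.
under eq_integral do rewrite EFinM.
rewrite ge0_integralZl_EFin//; last 2 first.
- apply/measurable_EFinP; apply: measurable_indic.
  exact: measurable_layer.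
- exact: ltW.
rewrite integral_indic//; last exact: measurable_layer.
rewrite (_ : layer i `&` D = layer i); last by apply/setIidPl => x [].
by rewrite EFinM fineK// fin_num_measure//; exact: measurable_layer.
Qed.

Let measurable_step n : measurable_fun D (step n).
Proof.
apply: measurable_sum => i; apply: measurable_funM => //.
by apply: measurable_indic; exact: measurable_layer.
Qed.

Let step_ge0 n x : (0 <= step n x)%R.
Proof. by apply: sumr_ge0 => i _; rewrite mulr_ge0// ltW. Qed.

Lemma layer_cake_le n :
  (e * \sum_(i < n) fine (a (layer i)))%:E <= \int[a]_(x in D) (g x)%:E.
Proof.
rewrite -integral_step; apply: ge0_le_integral => //.
- by move=> x _; rewrite lee_fin.
- by apply/measurable_EFinP; exact: measurable_step.
- by apply/measurable_EFinP.
- by move=> x Dx; rewrite lee_fin; have [] := step_le n Dx.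
Qed.

(** Both layer-cake bounds compare [g] with [e] times the number of the
    thresholds [e, 2 * e], up to [n * e], that do not exceed its value. *)
Lemma layer_cake_ge n : (forall x, D x -> g x <= n%:R * e)%R ->
  \int[a]_(x in D) (g x)%:E <=
    (e * \sum_(i < n) fine (a (layer i)) + e * fine (a D))%:E.
Proof.
move=> gn; rewrite EFinD -integral_step.
have -> : (e * fine (a D))%:E = \int[a]_(x in D) (cst e x)%:E.
  by rewrite (integral_cst a mD e%:E) EFinM fineK// fin_num_measure.
rewrite -ge0_integralD//; [|by move=> x _; rewrite lee_fin|
  by apply/measurable_EFinP; exact: measurable_step|
  by move=> x _; rewrite lee_fin ltW|by apply/measurable_EFinP].
apply: ge0_le_integral => //.
- by apply/measurable_EFinP.
- by apply/measurable_EFinP; apply: measurable_funD => //; exact: measurable_step.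
- move=> x Dx; rewrite -EFinD lee_fin /=.
case: (step_ge n Dx) => // sn; apply: (le_trans (gn x Dx)).
  by apply: (le_trans sn); rewrite lerDl ltW.
Qed.

End layer_cake.

(** * Integration against a signed measure *)

Section bounded_measurable.
Context {disp : measure_display} {T : measurableType disp} {R : realType}.
Implicit Types (u v : T -> R).

Definition bounded_measurable (D : set T) u :=
  measurable_fun D u /\ exists M, forall x, D x -> (`|u x| <= M)%R.

Lemma bounded_measurable_integrable (p : {finite_measure set T -> \bar R}) D u :
  measurable D -> bounded_measurable D u -> p.-integrable D (EFin \o u).
Proof.
move=> mD [mu [M uM]]; apply: measurable_bounded_integrable => //.
  by rewrite ltey_eq fin_num_measure.
exists M; split; first exact: num_real.
by move=> x Mx y Dy; apply: le_trans (uM y Dy) _; exact: ltW.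
Qed.

Lemma le_integral_uniform (p : {finite_measure set T -> \bar R}) D u v (e : R) :
  measurable D -> bounded_measurable D u -> bounded_measurable D v ->
  (forall x, D x -> `|u x - v x| <= e)%R ->
  \int[p]_(x in D) (u x)%:E <= \int[p]_(x in D) (v x)%:E + (e * fine (p D))%:E.
Proof.
move=> mD bu bv uv.
have iu := bounded_measurable_integrable p mD bu.
have iv := bounded_measurable_integrable p mD bv.
have ie : p.-integrable D (EFin \o cst e) by exact: finite_measure_integrable_cst.
have -> : (e * fine (p D))%:E = \int[p]_(x in D) (cst e x)%:E.
  by rewrite (integral_cst p mD e%:E) EFinM fineK// fin_num_measure.
rewrite -(integralD mD iv ie); apply: le_integral => //; first exact: integrableD.
move=> x; rewrite inE => Dx; rewrite /= -EFinD lee_fin.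
by have := uv x Dx; rewrite ler_distl => /andP[_]; rewrite addrC.
Qed.

End bounded_measurable.

Section charge_integral.
Context {R : realType} {d : nat}.
Notation T := (borelRV R d).
Implicit Types (u v : T -> R).

(** The constant is the total variation of [f] on [D]. *)
Lemma charge_integral_uniform (f : {charge set T -> \bar R}) D : measurable D ->
  exists C : R, (0 <= C)%R /\ forall u v (e : R),
    bounded_measurable D u -> bounded_measurable D v ->
    (forall x, D x -> `|u x - v x| <= e)%R ->
    charge_integral f D (fun x => (u x)%:E) <=
    charge_integral f D (fun x => (v x)%:E) + (e * C)%:E.
Proof.
move=> mD; rewrite /charge_integral.
set p := jordan_pos _; set q := jordan_neg _.
exists (fine (p D) + fine (q D))%R; split; first by rewrite addr_ge0 ?fine_ge0.
move=> u v e bu bv uv.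
have vu x : D x -> (`|v x - u x| <= e)%R by rewrite distrC; exact: uv.
have := le_integral_uniform p mD bu bv uv.
have := le_integral_uniform q mD bv bu vu.
have fin (m : {finite_measure set T -> \bar R}) w : bounded_measurable D w ->
    \int[m]_(x in D) (w x)%:E \is a fin_num.
  by move=> bw; apply: integrable_fin_num => //; exact: bounded_measurable_integrable.
have := fin p u bu; have := fin p v bv; have := fin q u bu; have := fin q v bv.
move: (\int[q]_(x in D) (v x)%:E) (\int[q]_(x in D) (u x)%:E)
  (\int[p]_(x in D) (v x)%:E) (\int[p]_(x in D) (u x)%:E).
move=> [a| |] // [b| |] // [a'| |] // [b'| |] // _ _ _ _.
by rewrite -!EFinD !lee_fin mulrDr; lra.
Qed.

Lemma charge_integral_fin_num (f : {charge set T -> \bar R}) D u : measurable D ->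
  bounded_measurable D u -> charge_integral f D (fun x => (u x)%:E) \is a fin_num.
Proof.
move=> mD bu; rewrite /charge_integral fin_numB.
by rewrite !integrable_fin_num//; exact: bounded_measurable_integrable.
Qed.

End charge_integral.

(** * Convex functions of measures by duality *)

Section convex_integral_bounds.
Context {R : realType} {d : nat}.
Notation T := (borelRV R d).
Notation lam := (lebesgueRV R d).
Variables (psi : R -> \bar R) (k : R) (Omega : set T).
Hypotheses (psi_ge0 : nneg_valued psi) (psi_convex : convex_on_nneg psi)
  (psi_lsc : lsc_on_nneg psi) (k_gt0 : (0 < k)%R) (psi_growth : linear_growth psi k)
  (mO : measurable Omega) (lamO : lam Omega < +oo).

Definition affine_value (l : R * R) (s : R) : R := (l.1 * s + l.2)%R.

Fixpoint max_affine (l : nat -> R * R) (n : nat) (s : R) : R :=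
  if n is n'.+1 then Num.max (max_affine l n' s) (affine_value (l n') s) else 0%R.

Lemma max_affine_nd l s : nondecreasing_seq (fun n => max_affine l n s).
Proof.
by apply/nondecreasing_seqP => n; rewrite /= le_max lexx.
Qed.

Lemma max_affine_ge0 l n s : (0 <= max_affine l n s)%R.
Proof. exact: (max_affine_nd l s (leq0n n)). Qed.

Lemma max_affine_ge l j n s : (j < n)%N -> (affine_value (l j) s <= max_affine l n s)%R.
Proof.
move=> jn; apply: le_trans (max_affine_nd l s jn).
by rewrite /= le_max lexx orbT.
Qed.

Lemma measurable_max_affine l n (h : T -> R) : measurable_fun setT h ->
  measurable_fun setT (fun x => max_affine l n (h x)).
Proof.
move=> mh; elim: n => [|n IH].
  exact: measurable_cst.
apply: measurable_maxr => //; apply: measurable_funD => //.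
exact: measurable_funM.
Qed.

(** The maxima of finitely many affine minorants increase to [psi]; this makes
    [psi \o h] measurable and opens the way to monotone convergence. *)
Lemma exists_max_affine_cvg : exists l : nat -> R * R,
  [/\ l 0%N = (0, 0)%R, forall j, affine_minorant psi (l j) &
   forall s, (0 <= s)%R -> (max_affine l n s)%:E @[n --> \oo] --> psi s].
Proof.
have [l [l0 lmin lsup]] := exists_minorant_sequence psi_ge0 psi_convex psi_lsc psi_growth.
exists l; split=> // s s0.
have nd : nondecreasing_seq (fun n => (max_affine l n s)%:E).
  by move=> m n mn; rewrite lee_fin max_affine_nd.
suff -> : psi s = ereal_sup (range (fun n => (max_affine l n s)%:E)).
  exact: ereal_nondecreasing_cvgn.
apply/eqP; rewrite eq_le; apply/andP; split; last first.
  apply: ge_ereal_sup => _ [n _ <-]; elim: n => [|n IH].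
    by rewrite /= psi_ge0.
  by rewrite /= EFin_max ge_max IH lmin.
rewrite leNgt; apply/negP; set S := ereal_sup _ => Spsi.
have S0 : 0 <= S.
  by apply: ereal_sup_ubound; exists 0%N.
have Sfin : S = (fine S)%:E by rewrite fineK// ge0_fin_numE// (lt_le_trans Spsi)// leey.
have [j ] := lsup s (fine S) s0 (eq_ind _ (fun z => z < psi s) Spsi _ Sfin).
rewrite ltNge => /negP; apply; rewrite -lee_fin -Sfin.
apply: (@le_trans _ _ (max_affine l j.+1 s)%:E).
  by rewrite lee_fin (max_affine_ge l s (ltnSn j)).
by apply: ereal_sup_ubound; exists j.+1.
Qed.

Lemma measurable_psi (h : T -> R) : measurable_fun setT h -> (forall x, 0 <= h x)%R ->
  measurable_fun setT (psi \o h).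
Proof.
move=> mh h0; have [l [_ _ lcvg]] := exists_max_affine_cvg.
apply: (@emeasurable_fun_cvg _ _ _ _ (fun n x => (max_affine l n (h x))%:E)).
  by move=> n; apply/measurable_EFinP; exact: measurable_max_affine.
by move=> x _; exact: lcvg.
Qed.

(** The value selected by [get] belongs to the set it is selected from as soon
    as one decomposition exists, and the bounds below hold for an arbitrary
    decomposition. *)
Lemma convex_integralP (a : {finite_measure set T -> \bar R}) :
  exists h s, lebesgue_decomposition a h s /\
  convex_integral psi k Omega a = \int[lam]_(x in Omega) psi (h x) + k%:E * s Omega.
Proof.
have [h [s hs]] := lebesgue_decomposition_exists a.
set S := [set r | exists h s, lebesgue_decomposition a h s /\
  r = \int[lam]_(x in Omega) psi (h x) + k%:E * s Omega].
by apply: (@getPex _ S); exists (\int[lam]_(x in Omega) psi (h x) + k%:E * s Omega), h, s.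
Qed.

(** Unlike [f], the function [g] may have an infinite integral. *)
Lemma integral_minorant_le (D : set T) (f g : T -> \bar R) : measurable D ->
  lam.-integrable D f -> measurable_fun D g -> (forall x, D x -> 0 <= g x) ->
  (forall x, D x -> f x <= g x) ->
  \int[lam]_(x in D) f x <= \int[lam]_(x in D) g x.
Proof.
move=> mD fi mg g0 fg; have fpi := integrable_funepos mD fi.
apply: (@le_trans _ _ (\int[lam]_(x in D) f^\+ x)).
  by apply: le_integral => // x _; rewrite funeposE le_max lexx.
apply: ge0_le_integral => //; first exact: measurable_int fpi.
by move=> x Dx; rewrite funeposE ge_max fg// g0.
Qed.

Section decomposed.
Variables (a : {finite_measure set T -> \bar R}) (h : T -> R)
  (s : {measure set T -> \bar R}).
Hypothesis dec : lebesgue_decomposition a h s.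

Let mh : measurable_fun setT h. Proof. by case: dec. Qed.
Let h_ge0 x : (0 <= h x)%R. Proof. by case: dec. Qed.
Let aE A : measurable A -> a A = \int[lam]_(x in A) (h x)%:E + s A.
Proof. by case: dec => _ _ _; apply. Qed.

Let inth_ge0 A : 0 <= \int[lam]_(x in A) (h x)%:E.
Proof. by apply: integral_ge0 => x _; rewrite lee_fin. Qed.

Let inth_fin A : measurable A -> \int[lam]_(x in A) (h x)%:E \is a fin_num.
Proof.
move=> mA; rewrite ge0_fin_numE//; have : a A < +oo by rewrite ltey_eq fin_num_measure.
by apply: le_lt_trans; rewrite aE// leeDl.
Qed.

Lemma singular_fin_num A : measurable A -> s A \is a fin_num.
Proof.
move=> mA; rewrite ge0_fin_numE//; have : a A < +oo by rewrite ltey_eq fin_num_measure.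
by apply: le_lt_trans; rewrite aE// leeDr.
Qed.

Let lam_fin A : measurable A -> A `<=` Omega -> lam A < +oo.
Proof. by move=> mA AO; apply: le_lt_trans lamO; apply: le_measure; rewrite ?inE. Qed.

Let h_integrable A : measurable A -> lam.-integrable A (EFin \o h).
Proof.
move=> mA; apply/integrableP; split.
  by apply/measurable_EFinP; exact: measurable_funTS.
under eq_integral do rewrite /= ger0_norm//.
by rewrite -ge0_fin_numE ?inth_fin.
Qed.

Let cst_integrable A c : measurable A -> A `<=` Omega ->
  lam.-integrable A (EFin \o cst c).
Proof.
move=> mA AO; apply: measurable_bounded_integrable => //; first exact: lam_fin.
by exists `|c|%R; split=> [|y cy x _]; [exact: num_real|exact: ltW].
Qed.

Lemma affine_integrable (l : R * R) A : measurable A -> A `<=` Omega ->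
  lam.-integrable A (fun x => (affine_value l (h x))%:E).
Proof.
move=> mA AO.
exact: (integrableD mA (integrableZl mA l.1 (h_integrable mA))
  (cst_integrable l.2 mA AO)).
Qed.

Lemma affine_measureE (l : R * R) A : measurable A -> A `<=` Omega ->
  (l.1 * fine (a A) + l.2 * fine (lam A))%:E =
  \int[lam]_(x in A) (affine_value l (h x))%:E + l.1%:E * s A.
Proof.
move=> mA AO.
have -> : \int[lam]_(x in A) (affine_value l (h x))%:E =
    l.1%:E * \int[lam]_(x in A) (h x)%:E + l.2%:E * lam A.
  rewrite -(integral_cst lam mA) -(integralZl mA (h_integrable mA)) -integralD//.
    by apply: integrableZl => //; exact: h_integrable.
  exact: cst_integrable.
have lA : lam A \is a fin_num by rewrite ge0_fin_numE// lam_fin.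
rewrite aE//; move: lA (inth_fin mA) (singular_fin_num mA).
move: (lam A) (\int[lam]_(x in A) (h x)%:E) (s A) => [x| |] // [y| |] // [z| |] // _ _ _.
by rewrite -!EFinM -!EFinD /=; congr (_%:E); ring.
Qed.

(** The minorant is integrated against the absolutely continuous part, and
    against the singular part only its slope counts, which is at most [k]. *)
Lemma affine_measure_le (l : R * R) A : affine_minorant psi l ->
  measurable A -> A `<=` Omega ->
  (l.1 * fine (a A) + l.2 * fine (lam A))%:E <=
  \int[lam]_(x in A) psi (h x) + k%:E * s A.
Proof.
move=> lmin mA AO; rewrite affine_measureE//; apply: leeD.
  apply: integral_minorant_le => //; first exact: affine_integrable.
  - by apply: measurable_funTS; exact: measurable_psi.
  - by move=> x _; exact: psi_ge0.
  - by move=> x _; exact: lmin.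
by rewrite lee_wpmul2r// lee_fin; exact: affine_minorant_slope_le lmin.
Qed.

End decomposed.

Lemma convex_integral_ge (a : {finite_measure set T -> \bar R}) n l (U : nat -> set T) :
  (forall i, affine_minorant psi (l i)) ->
  (forall i, measurable (U i)) -> (forall i, U i `<=` Omega) -> trivIset setT U ->
  (\sum_(i < n) ((l i).1 * fine (a (U i)) + (l i).2 * fine (lam (U i))))%:E <=
  convex_integral psi k Omega a.
Proof.
move=> lmin mU UO tU; have [h [s [dec ->]]] := convex_integralP a.
have [mh h0 _ _] := dec.
have mUU : measurable (\big[setU/set0]_(i < n) U i) by exact: bigsetU_measurable.
have UUO : \big[setU/set0]_(i < n) U i `<=` Omega.
  by rewrite -bigcup_mkord => x [i _ /UO].
have mpsi := measurable_psi mh h0.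
rewrite -sumEFin.
apply: (@le_trans _ _ (\sum_(i < n) (\int[lam]_(x in U i) psi (h x) + k%:E * s (U i)))).
  by apply: lee_sum => i _; exact: affine_measure_le.
rewrite big_split/=; apply: leeD.
  rewrite -(big_mkord xpredT (fun i => \int[lam]_(x in U i) psi (h x))).
  rewrite -ge0_integral_bigsetU//; last 4 first.
  - exact: iota_uniq.
  - exact: sub_trivIset tU.
  - exact: measurable_funTS.
  - by move=> x _; exact: psi_ge0.
  rewrite big_mkord; apply: ge0_subset_integral => //; first exact: measurable_funTS.
  by move=> x _; exact: psi_ge0.
rewrite -ge0_sume_distrr// -measure_bigsetU//.
by rewrite lee_wpmul2l ?lee_fin ?(ltW k_gt0)// le_measure ?inE.
Qed.

Lemma max_affine_argmax l n (s : R) : l 0%N = (0, 0)%R ->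
  exists2 j, (j <= n)%N & (max_affine l n.+1 s <= affine_value (l j) s)%R.
Proof.
move=> l0; elim: n => [|n [j jn IH]].
  by exists 0%N; rewrite //= /affine_value l0 /= mul0r addr0 maxxx.
have [h|h] := leP (max_affine l n.+1 s) (affine_value (l n.+1) s).
  by exists n.+1 => //; rewrite [leLHS]/= -/(max_affine l n.+1 s) max_r.
exists j; first exact: leqW.
by rewrite [leLHS]/= -/(max_affine l n.+1 s) max_l// ltW.
Qed.

Section bound_from_borel_families.
Variables (a : {finite_measure set T -> \bar R}) (C : R).
Hypothesis aC : forall n (l : nat -> R * R) (B : nat -> set T),
  (forall i, affine_minorant psi (l i)) ->
  (forall i, measurable (B i)) -> (forall i, B i `<=` Omega) -> trivIset setT B ->
  (\sum_(i < n) ((l i).1 * fine (a (B i)) + (l i).2 * fine (lam (B i))) <= C)%R.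

(** The optimal families: off the null set [N] carrying [s], one set for each
    index attaining the maximum of the affine functions, and on [N] any minorant
    [q], whose constant term has no effect there. *)
Let max_affine_bound (h : T -> R) (s : {measure set T -> \bar R}) l n (q : R * R) :
  lebesgue_decomposition a h s -> l 0%N = (0, 0)%R ->
  (forall j, affine_minorant psi (l j)) -> affine_minorant psi q ->
  \int[lam]_(x in Omega) (max_affine l n.+1 (h x))%:E + q.1%:E * s Omega <= C%:E.
Proof.
move=> dec l0 lmin qmin; have [mh h0 [N [mN lamN sN]] aE] := dec.
have mON : measurable (Omega `\` N) by exact: measurableD.
have mOIN : measurable (Omega `&` N) by exact: measurableI.
have mmax := measurable_max_affine l n.+1 mh.
pose A j := (Omega `\` N) `&`
  [set x | max_affine l n.+1 (h x) <= affine_value (l j) (h x)]%R.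
have mA j : measurable (A j).
  have := @measurable_fun_ler _ T R setT _ _ mmax
    (measurable_funD (measurable_funM (measurable_cst (l j).1) mh) (measurable_cst (l j).2)).
  move=> /(_ measurableT [set true] I) m1.
  by apply: measurableI => //; rewrite setTI in m1; exact: m1.
pose B j := if (j <= n)%N then seqDU A j else
  if j == n.+1 then Omega `&` N else set0.
have mB j : measurable (B j).
  rewrite /B; case: ifP => _; last by case: ifP.
  by apply: measurableD => //; exact: bigsetU_measurable.
have BO j : B j `<=` Omega.
  rewrite /B; case: ifP => _; last by case: ifP => // _ x [].
  by move=> x [[[]]].
have BN j : (j <= n)%N -> B j `<=` ~` N by move=> jn; rewrite /B jn => x [[[]]].
(* [seqDU] breaks the ties: each point goes to the least maximizing index. *)
have tB : trivIset setT B.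
  apply: ltn_trivIset => j i ij; rewrite -subset0.
  case: (leqP j n) => [jn|]; last first.
    rewrite leq_eqVlt => /predU1P[jE|jn]; last first.
      by rewrite {2}/B leqNgt (ltnW jn)/= gtn_eqF// => x [].
    have i_n : (i <= n)%N by rewrite -ltnS jE.
    by move=> x [/(BN i i_n) Nx]; rewrite /B -jE ltnn eqxx => -[].
  rewrite /B jn (leq_trans (ltnW ij) jn) => x Bx.
  have /trivIsetP/(_ i j I I) := trivIset_seqDU A.
  by rewrite ltn_eqF// => /(_ isT); rewrite -subset0; apply.
pose l' j := if j == n.+1 then q else l j.
have l'min j : affine_minorant psi (l' j) by rewrite /l'; case: ifP.
have null A' : measurable A' -> A' `<=` ~` N -> s A' = 0.
  move=> mA' A'N; apply/eqP; rewrite eq_le measure_ge0 andbT -sN.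
  by rewrite le_measure ?inE//; exact: measurableC.
have sO : s (Omega `&` N) = s Omega.
  rewrite -[in RHS](setUIDK Omega N) measureU//.
    by rewrite [X in _ = _ + X]null ?adde0// => x [].
  by rewrite -subset0 => x [[_ ?] []].
have := aC n.+2 l'min mB BO tB; rewrite -lee_fin; apply: le_trans.
rewrite big_ord_recr/= EFinD; apply: leeD; last first.
  rewrite /l' eqxx {1 2}/B ltnn eqxx (affine_measureE dec)//.
  rewrite null_set_integral ?add0e ?sO//.
    apply: measurable_int (affine_integrable dec _ _ _) => //.
  by apply/eqP; rewrite eq_le measure_ge0 andbT -lamN le_measure ?inE.
have max_ge0 A' x : A' x -> 0 <= (max_affine l n.+1 (h x))%:E.
  by move=> _; rewrite lee_fin max_affine_ge0.
have mmaxE A' : measurable_fun A' (fun x => (max_affine l n.+1 (h x))%:E).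
  by apply/measurable_EFinP; exact: measurable_funTS.
rewrite (ge0_negligible_integral mN mO (mmaxE _) (max_ge0 _) lamN).
have -> : Omega `\` N = \big[setU/set0]_(0 <= i < n.+1) B i.
  rewrite big_mkord; apply/seteqP; split=> [x ONx|].
    have [j jn xj] := max_affine_argmax n (h x) l0.
    have : (\big[setU/set0]_(i < n.+1) A i) x.
      by rewrite -bigcup_mkord; exists j.
    rewrite bigsetU_seqDU -!bigcup_mkord => -[i /= i_n Ax]; exists i => //.
    by rewrite /B -ltnS i_n.
  rewrite -bigcup_mkord => x [i /= i_n Bx]; split; first exact: BO Bx.
  exact: BN Bx.
rewrite ge0_integral_bigsetU//; last 3 first.
- exact: iota_uniq.
- exact: sub_trivIset tB.
- exact: max_ge0.
rewrite big_mkord -sumEFin; apply: lee_sum => i _.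
have i_n : (i <= n)%N by rewrite -ltnS.
rewrite /l' ltn_eqF// (affine_measureE dec)// (null (B i))//; last exact: BN.
rewrite mule0 adde0; apply: ge0_le_integral => //.
- exact: max_ge0.
- exact: measurable_int (affine_integrable dec (l i) (mB i) (@BO i)).
- by move=> x; rewrite /B i_n => -[[_ le_x] _]; rewrite lee_fin.
Qed.

(** The bounds for finite maxima pass to [psi] by monotone convergence, and to the
    recession slope [k] by letting the slope of [q] tend to [k]. *)
Lemma convex_integral_le : convex_integral psi k Omega a <= C%:E.
Proof.
have [h [s [dec ->]]] := convex_integralP a; have [mh h0 _ _] := dec.
have [l [l0 lmin lcvg]] := exists_max_affine_cvg.
have sfin : s Omega \is a fin_num by exact: (singular_fin_num dec mO).
have psiq q : affine_minorant psi q ->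
    \int[lam]_(x in Omega) psi (h x) <= C%:E - q.1%:E * s Omega.
  move=> qmin; pose g n x := (max_affine l n (h x))%:E.
  have mg n : measurable_fun Omega (g n).
    by apply/measurable_EFinP; apply: measurable_funTS; exact: measurable_max_affine.
  have -> : \int[lam]_(x in Omega) psi (h x) = \int[lam]_(x in Omega) limn (g ^~ x).
    by apply: eq_integral => x _; apply/esym/cvg_lim => //; exact: lcvg.
  rewrite monotone_convergence//; last 2 first.
  - by move=> n x _; rewrite lee_fin max_affine_ge0.
  - by move=> x _ m n mn; rewrite lee_fin max_affine_nd.
  apply: lime_le.
    apply: ereal_nondecreasing_is_cvgn => m n mn; apply: ge0_le_integral => //.
    + by move=> x _; rewrite lee_fin max_affine_ge0.
    + by move=> x _; rewrite lee_fin max_affine_nd.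
  exists 1%N => // -[//|n] _.
  by rewrite leeBrDr ?fin_numM//; exact: max_affine_bound.
have s0 : (0 <= fine (s Omega))%R by rewrite fine_ge0.
have psi0 : 0 <= \int[lam]_(x in Omega) psi (h x).
  by apply: integral_ge0 => x _; exact: psi_ge0.
move: psiq psi0; rewrite -(fineK sfin); move: (fine _) s0 => y y0.
case: (\int[lam]_(x in Omega) psi (h x)) => [z psiq _| psiq |//]; last first.
  by have := psiq _ (affine_minorant0 psi_ge0); rewrite leye_eq -EFinM -EFinB.
rewrite -EFinM -EFinD lee_fin; apply/ler_addgt0Pr => e e0.
have d0 : (0 < e / (y + 1))%R by rewrite divr_gt0// ltr_wpDl.
have [|be qmin] := @affine_minorant_slope _ _ _ psi_ge0 psi_growth (k - e / (y + 1))%R.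
  by rewrite ltrBlDr ltrDl.
have := psiq _ qmin; rewrite -EFinM -EFinB lee_fin /= => h1.
have : (e / (y + 1) * y <= e)%R.
  by rewrite mulrAC ler_pdivrMr ?ltr_wpDl// ler_pM2l// lerDl.
by move: h1; rewrite mulrBl; lra.
Qed.

End bound_from_borel_families.

End convex_integral_bounds.

(** * Transfer from open sets to Borel sets *)

Section open_to_borel.
Context {R : realType} {d : nat}.
Notation T := (borelRV R d).
Variables (mu lam : {finite_measure set T -> \bar R}) (m : set T -> R).
Variable Omega : set 'rV[R]_d.
Hypotheses (oO : open Omega) (bO : bounded_set Omega).
Hypothesis m_mono : forall A B : set T, measurable A -> measurable B ->
  A `<=` B -> (m A <= m B)%R.
Hypothesis muU : forall U : set 'rV[R]_d, open U -> U `<=` Omega -> mu U <= (m U)%:E.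
Hypothesis muK : forall (K : set 'rV[R]_d) (e : R), compact K -> K `<=` Omega ->
  (0 < e)%R ->
  exists U : set 'rV[R]_d, [/\ open U, K `<=` U & (m U)%:E <= mu K + e%:E].

Lemma compact_le_weak_limit (K : set 'rV[R]_d) : compact K -> closed K ->
  K `<=` Omega -> (m K)%:E <= mu K.
Proof.
move=> cK clK KO; apply/lee_addgt0Pr => e e0.
have [U [oU KU h]] := muK cK KO e0; apply: le_trans h.
by rewrite lee_fin; apply: m_mono => //; [exact: measurable_closedRV|exact: measurable_openRV].
Qed.

(** Two-sided closeness is needed since minorants may have negative slopes and
    constants.  Lower bounds for [m U] come from [muU], upper bounds from [muK]. *)
Lemma open_approximation (B V : set T) (K : set 'rV[R]_d) (e : R) : measurable B ->
  (0 < e)%R -> K `<=` B -> B `<=` Omega -> compact K -> closed K ->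
  @open 'rV[R]_d V -> K `<=` V ->
  mu B <= mu K + e%:E -> lam B <= lam K + e%:E ->
  exists U : set 'rV[R]_d, [/\ open U, U `<=` V `&` Omega,
    (`|m U - fine (mu B)| <= e)%R & (`|fine (lam U) - fine (lam B)| <= e)%R].
Proof.
move=> mB e0 KB BO cK clK oV KV muBK lamBK.
have mK := measurable_closedRV clK; have KO := subset_trans KB BO.
have [W1 [oW1 KW1 mW1]] := muK cK KO e0.
have [W2 [oW2 KW2 lamW2]] := open_outer_regular lam mK e0.
pose U : set 'rV[R]_d := (V `&` Omega) `&` (W1 `&` W2).
have oU : open U by do !apply: openI.
have KU : K `<=` U by move=> x Kx; split; split; [exact: KV|exact: KO|exact: KW1|exact: KW2].
have mU := measurable_openRV oU.
have le_mu (nu : {finite_measure set T -> \bar R}) (A A' : set T) :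
    measurable A -> measurable A' ->
    A `<=` A' -> nu A <= nu A' by move=> mA mA' AA'; rewrite le_measure ?inE.
exists U; split=> //.
- by move=> x [].
- have h1 : (m U)%:E <= mu B + e%:E.
    apply: (@le_trans _ _ (m W1)%:E).
      rewrite lee_fin; apply: m_mono => //; first exact: measurable_openRV.
      by move=> x [_ []].
    by apply: (le_trans mW1); rewrite leeD2r// le_mu.
  have h2 : mu B <= (m U)%:E + e%:E.
    apply: (le_trans muBK); rewrite leeD2r//; apply: le_trans (muU oU _); first exact: le_mu.
    by move=> x [[]].
  move: h1 h2; have := fin_num_measure mu B mB.
  case: (mu B) => // y _; rewrite -!EFinD !lee_fin ler_distl => h1 h2.
  by apply/andP; split; rewrite /=; lra.
- have h1 : lam U <= lam B + e%:E.
    apply: (@le_trans _ _ (lam W2)).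
      apply: le_mu => //; first exact: measurable_openRV.
      by move=> x [_ []].
    by apply: (le_trans lamW2); rewrite leeD2r// le_mu.
  have h2 : lam B <= lam U + e%:E.
    by apply: (le_trans lamBK); rewrite leeD2r// le_mu.
  move: h1 h2; rewrite -(fineK (fin_num_measure lam B mB)).
  rewrite -(fineK (fin_num_measure lam U mU)) -!EFinD !lee_fin ler_distl => h1 h2.
  by apply/andP; split; rewrite /=; lra.
Qed.

Lemma compact_approximation (B : set T) (e : R) : measurable B -> B `<=` Omega ->
  (0 < e)%R -> exists K : set 'rV[R]_d, [/\ closed K, compact K, K `<=` B,
    mu B <= mu K + e%:E & lam B <= lam K + e%:E].
Proof.
move=> mB BO e0; have [C1 [cC1 C1B h1]] := closed_inner_regular mu mB e0.
have [C2 [cC2 C2B h2]] := closed_inner_regular lam mB e0.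
have cC : closed (C1 `|` C2) by exact: closedU.
have CB : C1 `|` C2 `<=` B by move=> x [/C1B|/C2B].
exists (C1 `|` C2); split=> //.
- apply: bounded_closed_compact => //.
  have [M [Mr MO]] := bO; exists M; split=> [//|s Ms x Cx].
  by apply: (MO s Ms x); apply: BO; exact: CB.
- apply: (le_trans h1); rewrite leeD2r//.
  by apply: le_measure; rewrite ?inE; [exact: measurable_closedRV..|exact: subsetUl].
- apply: (le_trans h2); rewrite leeD2r//.
  by apply: le_measure; rewrite ?inE; [exact: measurable_closedRV..|exact: subsetUr].
Qed.

(** Disjointness survives the passage to open sets because disjoint closed inner
    approximations have disjoint open neighbourhoods. *)
Lemma borel_families_bound (C : R) (n : nat) (l : nat -> R * R) :
  (forall U : nat -> set 'rV[R]_d, (forall i, open (U i)) -> (forall i, U i `<=` Omega) ->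
    trivIset setT U ->
    (\sum_(i < n) ((l i).1 * m (U i) + (l i).2 * fine (lam (U i))) <= C)%R) ->
  forall B : nat -> set T, (forall i, measurable (B i)) -> (forall i, B i `<=` Omega) ->
    trivIset setT B ->
    (\sum_(i < n) ((l i).1 * fine (mu (B i)) + (l i).2 * fine (lam (B i))) <= C)%R.
Proof.
move=> openC B mB BO tB; apply/ler_addgt0Pr => e' e'0.
pose L := (\sum_(i < n) (`|(l i).1| + `|(l i).2|) + 1)%R.
have L0 : (0 < L)%R by rewrite ltr_wpDl// sumr_ge0// => i _; rewrite addr_ge0.
pose e := (e' / L)%R; have e0 : (0 < e)%R by rewrite divr_gt0.
have /choice[K KP] := fun i => compact_approximation (mB i) (@BO i) e0.
have [|i j ij|V [oV KV dV]] := @closed_separation R 'rV[R]_d 'I_n (fun i => K i).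
- by move=> i; have [] := KP i.
- have /trivIsetP/(_ i j I I ij) := tB; rewrite -!subset0 => BB x [Kix Kjx].
  by apply: (BB x); split; [have [_ _ h _ _] := KP i|have [_ _ h _ _] := KP j]; exact: h.
have /choice[U UP] (i : 'I_n) : exists U : set 'rV[R]_d, [/\ open U, U `<=` V i `&` Omega,
    (`|m U - fine (mu (B i))| <= e)%R & (`|fine (lam U) - fine (lam (B i))| <= e)%R].
  have [clK cK KB h1 h2] := KP i.
  exact: (open_approximation (mB i) e0 KB (@BO i) cK clK (oV i) (KV i) h1 h2).
pose U' i := if insub i is Some j then U j else set0.
have oU' i : open (U' i).
  by rewrite /U'; case: insubP => [j _ _|_]; [have [] := UP j|exact: open0].
have U'O i : U' i `<=` Omega.
  by rewrite /U'; case: insubP => [j _ _|_ //]; have [_ h _ _] := UP j => x /h[].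
have tU' : trivIset setT U'.
  apply/trivIsetP => i j _ _ ij; rewrite /U'.
  case: insubP => [i' _ ii|_]; last by rewrite set0I.
  case: insubP => [j' _ jj|_]; last by rewrite setI0.
  have /dV : i' != j' by apply: contraNneq ij => ij'; rewrite -ii -jj ij'.
  rewrite -!subset0 => VV x [Ux Ux']; apply: (VV x).
  have [_ h _ _] := UP i'; have [_ h' _ _] := UP j'.
  by split; [have [] := h x Ux|have [] := h' x Ux'].
apply: le_trans (_ : _ <= (\sum_(i < n)
  ((l i).1 * m (U' i) + (l i).2 * fine (lam (U' i)))) + e')%R _; last first.
  by rewrite lerD2r; exact: openC.
have -> : (e' = e * L)%R by rewrite /e divfK// gt_eqF.
have -> : (\sum_(i < n) ((l i).1 * m (U' i) + (l i).2 * fine (lam (U' i))) + e * L =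
    \sum_(i < n) ((l i).1 * m (U' i) + (l i).2 * fine (lam (U' i)) +
      e * (`|(l i).1| + `|(l i).2|)) + e)%R.
  by rewrite /L mulrDr mulr1 addrA [in RHS]big_split/= -mulr_sumr.
apply: (@le_trans _ _ (\sum_(i < n) ((l i).1 * m (U' i) + (l i).2 * fine (lam (U' i)) +
      e * (`|(l i).1| + `|(l i).2|)))%R); last by rewrite lerDl ltW.
apply: ler_sum => i _; rewrite /U' valK.
have [_ _ h1 h2] := UP i.
have bd (c x y : R) : (`|x - y| <= e -> c * y <= c * x + e * `|c|)%R.
  move=> xy; rewrite -lerBlDl -mulrBr (le_trans (ler_norm _))// normrM mulrC.
  by rewrite ler_wpM2r// distrC.
by have := bd (l i).1 _ _ h1; have := bd (l i).2 _ _ h2; rewrite mulrDr; lra.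
Qed.

End open_to_borel.

(** * Upper semicontinuity of the energy *)

Section optimal_coefficient.
Context {R : realType} {d : nat}.
Notation T := (borelRV R d).
Notation lam := (lebesgueRV R d).
Variables (Omega : set 'rV[R]_d) (f : {charge set T -> \bar R}) (psi : R -> \bar R) (k : R).
Hypotheses (oO : open Omega) (bO : bounded_set Omega).
Hypotheses (psi_ge0 : nneg_valued psi) (psi_convex : convex_on_nneg psi)
  (psi_lsc : lsc_on_nneg psi) (k_gt0 : (0 < k)%R) (psi_growth : linear_growth psi k).
Implicit Types (a : {finite_measure set T -> \bar R}) (u v : 'rV[R]_d -> R).

Let mO : measurable (Omega : set T). Proof. exact: measurable_openRV. Qed.
Let lamO : lam Omega < +oo. Proof. exact: lebesgueRV_bounded. Qed.

Notation F u := (charge_integral f Omega (fun x => (u x)%:E)).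
Notation dirichlet a u := (\int[a]_(x in Omega) (sqnorm_grad u x)%:E).
Notation CI a := (convex_integral psi k Omega a).

Lemma sqnorm_grad_ge0 u x : (0 <= sqnorm_grad u x)%R.
Proof. by apply: sumr_ge0 => i _; exact: sqr_ge0. Qed.

Lemma C10_bounded_measurable u : C10 Omega u -> bounded_measurable (Omega : set T) u.
Proof.
move=> uC; split; last exact: C10_bounded uC.
by apply: measurable_fun_continuousRV => // x; exact: C10_continuous.
Qed.

Lemma measurable_sqnorm_grad u : C10 Omega u ->
  measurable_fun (Omega : set T) (sqnorm_grad u : T -> R).
Proof.
by move=> uC; apply: measurable_fun_continuousRV => // x; exact: continuous_sqnorm_grad.
Qed.

Lemma C10_cst0 : C10 Omega (cst 0%R : 'rV[R]_d -> R).
Proof.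
split=> [x _|i x _|x _]; first exact: differentiable_cst.
- rewrite (_ : pderiv _ i = cst 0%R); first exact: cst_continuous.
  by apply/funext => y; exact: derive_cst.
- exact: cvg_cst.
Qed.

Lemma sqnorm_grad_cst0 (x : 'rV[R]_d) :
  sqnorm_grad (cst 0%R : 'rV[R]_d -> R) x = 0%R.
Proof.
by rewrite /sqnorm_grad big1// => i _; rewrite /pderiv derive_cst expr0n.
Qed.

Lemma convex_integral_ge0 a : 0 <= CI a.
Proof.
have := @convex_integral_ge R d psi k Omega psi_ge0 psi_convex psi_lsc k_gt0 psi_growth
  mO lamO a 0 (fun=> (0, 0)%R) (fun=> set0).
rewrite big_ord0; apply=> //; first by move=> _; exact: affine_minorant0.
  by move=> _; exact: sub0set.
by apply/trivIsetP => i j _ _ _; rewrite set0I.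
Qed.

Lemma energy_le0 a : energy f psi k Omega a <= - ((2^-1)%:E * CI a).
Proof.
apply: ereal_inf_lbound; exists (cst 0%R); first exact: C10_cst0.
have -> : dirichlet a (cst 0%R) = 0.
  by under eq_integral do rewrite sqnorm_grad_cst0; rewrite integral0.
have -> : F (cst 0%R) = 0 by rewrite /charge_integral !integral0 sube0.
by rewrite mule0 sube0 add0e.
Qed.

(** A lower bound on the energy is a family of upper bounds on the convex
    integral, one for each test function; in this form everything is finite. *)
Lemma energy_lt_convex_integral a v (c I : R) : C10 Omega v ->
  dirichlet a v <= I%:E -> c%:E < energy f psi k Omega a ->
  CI a <= (I - 2 * fine (F v) - 2 * c)%:E.
Proof.
move=> vC vI cE.
have Ffin : F v \is a fin_num.
  by apply: charge_integral_fin_num => //; exact: C10_bounded_measurable.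
have d0 : 0 <= dirichlet a v.
  by apply: integral_ge0 => x _; rewrite lee_fin sqnorm_grad_ge0.
have : c%:E < (2^-1)%:E * dirichlet a v - F v - (2^-1)%:E * CI a.
  by apply: lt_le_trans cE _; apply: ereal_inf_lbound; exists v.
rewrite -{1}(fineK Ffin); move: vI d0 (convex_integral_ge0 a).
case: (dirichlet a v) => [z| |] //.
case: (CI a) => [y| |] // zI _ _.
- rewrite -!EFinM -!EFinB !lte_fin lee_fin; move: zI; rewrite lee_fin; lra.
- by rewrite gt0_muley ?lte_fin ?invr_gt0// addeNy ltNge leNye.
Qed.

Lemma mass_bound (c : R) : exists M : R, forall a, concentrated_on a Omega ->
  c%:E < energy f psi k Omega a -> a setT <= M%:E.
Proof.
have [|be qmin] := @affine_minorant_slope _ _ _ psi_ge0 psi_growth (k / 2)%R.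
  by rewrite ltr_pdivrMr// ltr_pMr// ltr1n.
exists ((- 2 * c - be * fine (lam Omega)) / (k / 2))%R => a aO cE.
have CIc : CI a <= (- 2 * c)%:E.
  have := @energy_lt_convex_integral a (cst 0%R) c 0%R C10_cst0 _ cE.
  rewrite (_ : F (cst 0%R) = 0) ?mulr0 ?subr0 ?sub0r ?mulNr; last first.
    by rewrite /charge_integral !integral0 sube0.
  apply; under eq_integral do rewrite sqnorm_grad_cst0.
  by rewrite integral0.
pose U i : set T := if i is 0%N then Omega else set0.
have := @convex_integral_ge R d psi k Omega psi_ge0 psi_convex psi_lsc k_gt0 psi_growth
  mO lamO a 1 (fun=> (k / 2, be)%R) U.
move=> /(_ (fun=> qmin)) h.
have {h} : ((k / 2) * fine (a Omega) + be * fine (lam Omega))%:E <= CI a.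
  apply: le_trans (h _ _ _); first by rewrite big_ord1.
  - by case=> [|i]; [exact: mO|exact: measurable0].
  - by case=> [|i] x.
  - apply: ltn_trivIset => -[//|n] [|m] _; rewrite /U ?setI0//.
move=> /le_trans /(_ CIc); rewrite lee_fin => h.
have -> : a setT = a Omega.
  have mOC := measurableC mO; rewrite -[in LHS](setUv (Omega : set T)).
  by rewrite (measureU a mO mOC (setICr _)) [X in _ + X](aO _ mOC) ?adde0.
rewrite -(fineK (fin_num_measure a _ mO)) lee_fin ler_pdivlMr ?divr_gt0//.
by rewrite mulrC; lra.
Qed.

Section limit_of_sequence.
Variables (a_ : nat -> {finite_measure set T -> \bar R}) (M : R).
Hypothesis a_M : forall n, a_ n setT <= M%:E.
Variables (G : set_system nat) (GF : ProperFilter G) (m : set T -> R).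
Hypothesis mcvg : forall A, measurable A -> fine (a_ n A) @[n --> G] --> m A.
Variable a0 : {finite_measure set T -> \bar R}.
Hypothesis a0U : forall U : set 'rV[R]_d, open U -> U `<=` Omega -> a0 U <= (m U)%:E.
Hypothesis a0K : forall (K : set 'rV[R]_d) (e : R), compact K -> K `<=` Omega ->
  (0 < e)%R ->
  exists U : set 'rV[R]_d, [/\ open U, K `<=` U & (m U)%:E <= a0 K + e%:E].

Let m_mono (A B : set T) : measurable A -> measurable B ->
  A `<=` B -> (m A <= m B)%R.
Proof.
move=> mA mB AB; apply: (ler_cvg_to (mcvg mA) (mcvg mB)).
apply: nearW => n; apply: fine_le; rewrite ?fin_num_measure//.
by rewrite le_measure ?inE.
Qed.

(** The numbers [y n] are layer-cake sums over compact layers; they involve [a_ n]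
    only through its values on finitely many sets and therefore converge. *)
Let dirichlet_upper (v : 'rV[R]_d -> R) (K : set 'rV[R]_d) (e : R) :
  C10 Omega v -> compact K -> K `<=` Omega ->
  (forall x, Omega x -> ~ K x -> sqnorm_grad v x = 0%R) -> (0 < e)%R ->
  exists y : nat -> R, exists y0 : R,
  [/\ forall n, dirichlet (a_ n) v <= (y n)%:E, y n @[n --> G] --> y0,
      y0%:E <= dirichlet a0 v + e%:E & dirichlet a0 v \is a fin_num].
Proof.
move=> vC cK KO vK e0; pose g := sqnorm_grad v.
have cg x : K x -> {for x, continuous g}.
  by move=> Kx; apply: (continuous_sqnorm_grad vC); exact: (KO x Kx).
have [Mg gM] := continuous_compact_bounded cK cg.
have M0 : (0 <= M)%R by rewrite -lee_fin (le_trans _ (a_M 0%N)).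
pose e' := (e / (M + 1))%R.
have e'0 : (0 < e')%R by rewrite divr_gt0// ltr_wpDl.
have e'M : (e' * M <= e)%R.
  by rewrite /e' mulrAC ler_pdivrMr ?ltr_wpDl// ler_pM2l// lerDl.
pose p := Num.bound (`|Mg| / e').
have gp x : Omega x -> (g x <= p%:R * e')%R.
  move=> Ox; have pe : (0 <= p%:R * e')%R by rewrite mulr_ge0// ltW.
  have [Kx|nKx] := pselect (K x); last by rewrite /g vK.
  apply: (le_trans (ler_norm _)); apply: (le_trans (gM x Kx)).
  apply: (le_trans (ler_norm _)); rewrite -ler_pdivrMr//.
  by apply/ltW/archi_boundP; rewrite divr_ge0// ltW.
have clK : closed K by apply: compact_closed => //; exact: norm_hausdorff.
have mg := measurable_sqnorm_grad vC.
have g0 x : Omega x -> (0 <= g x)%R by move=> _; exact: sqnorm_grad_ge0.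
pose L i := layer (Omega : set T) (g : T -> R) e' i.
have LE i : L i = K `&` [set x | i.+1%:R * e' <= g x]%R.
  apply/seteqP; split=> [x [Ox gx]|x [Kx gx]]; last first.
    by split; [exact: (KO x Kx)|exact: gx].
  split; last exact: gx.
  apply: contrapT => nKx; move: gx; rewrite /= /g vK// leNgt => /negP; apply.
  by rewrite mulr_gt0.
have cL i : compact (L i : set 'rV[R]_d) by rewrite LE; exact: compact_superlevel.
have clL i : closed (L i : set 'rV[R]_d).
  by apply: compact_closed => //; exact: norm_hausdorff.
have mL i : measurable (L i) by exact: measurable_closedRV.
exists (fun n => e' * \sum_(i < p) fine (a_ n (L i)) + e)%R.
exists (e' * \sum_(i < p) m (L i) + e)%R; split.
- move=> n; apply: le_trans (layer_cake_ge (a_ n) mO mg g0 e'0 gp) _.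
  rewrite lee_fin lerD2l; apply: le_trans e'M; rewrite ler_pM2l//.
  rewrite -lee_fin fineK ?fin_num_measure//; apply: le_trans (a_M n).
  by rewrite le_measure ?inE.
- apply: cvgD; last exact: cvg_cst.
  apply: cvgM; first exact: cvg_cst.
  by apply: cvg_big => [|i _]; [exact: add_continuous|exact: (mcvg (mL i))].
- rewrite EFinD leeD2r//; apply: le_trans (layer_cake_le a0 mO mg g0 e'0 p).
  rewrite lee_fin ler_pM2l//; apply: ler_sum => i _.
  rewrite -lee_fin (fineK (fin_num_measure a0 _ (mL i))).
  by apply: (compact_le_weak_limit m_mono a0K) => // x [].
- apply: integrable_fin_num => //; apply: bounded_measurable_integrable => //.
  split=> //; exists (p%:R * e')%R => x Ox.
  by rewrite ger0_norm; [exact: gp|exact: g0].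
Qed.

(** The energy bound of the limit for a test function with compactly supported
    gradient.  By duality it suffices to bound the sums over disjoint open sets,
    and there both sides of the inequality for [a_ n] converge. *)
Lemma weak_limit_convex_integral (v : 'rV[R]_d -> R) (K : set 'rV[R]_d) (c : R) :
  C10 Omega v -> compact K -> K `<=` Omega ->
  (forall x, Omega x -> ~ K x -> sqnorm_grad v x = 0%R) ->
  (\forall n \near G, c%:E < energy f psi k Omega (a_ n)) ->
  dirichlet a0 v \is a fin_num /\
  CI a0 <= (fine (dirichlet a0 v) - 2 * fine (F v) - 2 * c)%:E.
Proof.
move=> vC cK KO vK cG.
have [_ [_ [_ _ _ fin]]] := dirichlet_upper vC cK KO vK ltr01; split=> //.
apply: convex_integral_le => // n l B lmin mB BO tB.
pose lamf := mfrestr mO lamO.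
have lamfE (A : set T) : A `<=` Omega -> lamf A = lam A.
  by move=> AO; rewrite /lamf/= /mfrestr /mrestr setIidl.
rewrite (eq_bigr (fun i : 'I_n =>
  (l i).1 * fine (a0 (B i)) + (l i).2 * fine (lamf (B i)))%R); last first.
  by move=> i _; rewrite lamfE.
apply: (borel_families_bound (lam := lamf) oO bO m_mono a0U a0K) => // U oU UO tU.
apply/ler_addgt0Pr => e e0.
have [y [y0 [ay ycvg y0e _]]] := dirichlet_upper vC cK KO vK e0.
have mU i : measurable (U i : set T) by exact: measurable_openRV.
have Ucvg : (\sum_(i < n) ((l i).1 * fine (a_ j (U i)) + (l i).2 * fine (lamf (U i))))%R
    @[j --> G] --> (\sum_(i < n) ((l i).1 * m (U i) + (l i).2 * fine (lamf (U i))))%R.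
  apply: cvg_big => [|i _]; first exact: add_continuous.
  by apply: cvgD; [apply: cvgM; [exact: cvg_cst|exact: mcvg]|exact: cvg_cst].
have ycvg' : (y j - 2 * fine (F v) - 2 * c)%R @[j --> G] -->
    (y0 - 2 * fine (F v) - 2 * c)%R.
  by do 2![apply: cvgB; last exact: cvg_cst].
apply: (@le_trans _ _ (y0 - 2 * fine (F v) - 2 * c)%R).
  apply: (ler_cvg_to Ucvg ycvg'); apply: filterS cG => j cE.
  rewrite -lee_fin; apply: le_trans (energy_lt_convex_integral vC (ay j) cE).
  under eq_bigr do rewrite lamfE//.
  exact: convex_integral_ge.
move: y0e; rewrite -(fineK fin) -EFinD lee_fin; lra.
Qed.

End limit_of_sequence.

End optimal_coefficient.

(** * Existence of an optimal coefficient *)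

Unset Implicit Arguments.

Theorem theorem2p2 (R : realType) (d : nat) (Omega : set 'rV[R]_d)
    (f : {charge set (borelRV R d) -> \bar R}) (psi : R -> \bar R) (k : R)
    (Omega_open : open Omega) (Omega_bounded : bounded_set Omega)
    (f_on : concentrated_on f Omega)
    (psi_ge0 : nneg_valued psi) (psi_convex : convex_on_nneg psi)
    (psi_lsc : lsc_on_nneg psi)
    (k_gt0 : (0 < k)%R) (psi_growth : linear_growth psi k)
    (energy_proper : exists a, finite_measures_on Omega a /\
      -oo < energy f psi k Omega a) :
  exists aopt, finite_measures_on Omega aopt /\
    forall a, finite_measures_on Omega a ->
      energy f psi k Omega a <= energy f psi k Omega aopt.
Proof.
have mO : measurable (Omega : set (borelRV R d)) by exact: measurable_openRV.
pose S := ereal_sup [set energy f psi k Omega a | a in finite_measures_on Omega].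
have Sfin : S \is a fin_num.
  rewrite fin_numE; apply/andP; split.
    have [a [aO aE]] := energy_proper.
    rewrite -ltNye; apply: lt_le_trans aE _.
    by apply: ereal_sup_ubound; exists a.
  rewrite -ltey; apply: (@le_lt_trans _ _ 0); last exact: ltry.
  apply: ge_ereal_sup => _ [a _ <-].
  have : energy f psi k Omega a <= - ((2^-1)%:E * convex_integral psi k Omega a).
    exact: energy_le0.
  move/le_trans; apply.
  rewrite leeNl oppe0 mule_ge0//.
  exact: convex_integral_ge0.
pose c0 := fine S.
have SE : S = c0%:E by rewrite fineK.
have /choice[a_ aP] n : exists a : {finite_measure set (borelRV R d) -> \bar R},
    concentrated_on a Omega /\
    (c0 - n.+1%:R^-1)%:E < energy f psi k Omega a.
  have n0 : (0 < n.+1%:R^-1 :> R)%R by rewrite invr_gt0.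
  have [_ [a aO <-] h] := ub_ereal_sup_adherent n0 Sfin.
  by exists a; split=> //; rewrite EFinB -SE.
have [M aM] := @mass_bound R d Omega f psi k Omega_open Omega_bounded psi_ge0
  psi_convex psi_lsc k_gt0 psi_growth (c0 - 1)%R.
have a_M n : a_ n setT <= M%:E.
  have [aO aE] := aP n; apply: aM => //; apply: le_lt_trans aE.
  by rewrite lee_fin lerD2l lerN2 invf_le1// ler1n.
have [G [m [mu [GF ooG mcvg muU muK]]]] := weak_compactness a_M.
have muO : mu Omega < +oo by rewrite ltey_eq fin_num_measure.
pose aopt : {finite_measure set (borelRV R d) -> \bar R} := mfrestr mO muO.
have aoptE (A : set (borelRV R d)) : A `<=` Omega -> aopt A = mu A.
  by move=> AO; rewrite /aopt/= /mfrestr /mrestr setIidl.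
exists aopt; split.
  move=> A mA AO; rewrite /aopt/= /mfrestr /mrestr.
  by rewrite (_ : A `&` Omega = set0) ?measure0// -subset0 => x [/AO].
suff SE' : S <= energy f psi k Omega aopt.
  by move=> a aO; apply: le_trans SE'; apply: ereal_sup_ubound; exists a.
have aoptU (U : set 'rV[R]_d) : open U -> U `<=` Omega -> aopt U <= (m U)%:E.
  by move=> oU UO; rewrite aoptE//; exact: muU.
have aoptK (K : set 'rV[R]_d) (e : R) : compact K -> K `<=` Omega -> (0 < e)%R ->
    exists U : set 'rV[R]_d, [/\ open U, K `<=` U & (m U)%:E <= aopt K + e%:E].
  by move=> cK KO e0; rewrite aoptE//; exact: muK.
rewrite SE; apply: le_ereal_inf_tmp => _ [u uC <-].
have [C [C0 HC]] := charge_integral_uniform f mO.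
have bu := C10_bounded_measurable Omega_open Omega_bounded uC.
have Fu := charge_integral_fin_num f mO bu.
apply/lee_addgt0Pr => e e0.
(* Truncating at level [r] moves [u] by at most [2 * r], which changes the
   integral against [f] by at most [e / 2]; the other half of [e] is the gap
   between the energies of the sequence and their supremum. *)
pose r := (e / 2 / (2 * (C + 1)))%R.
have r0 : (0 < r)%R by rewrite !divr_gt0// mulr_gt0// ltr_wpDl.
have rC : (2 * r * C <= e / 2)%R.
  have rE : (2 * r * (C + 1) = e / 2)%R.
    by rewrite mulrAC mulrC /r divfK// gt_eqF// mulr_gt0// ltr_wpDl.
  by move: r0 rE; clearbody r => r0; rewrite mulrDr mulr1; lra.
have [v [vC vu gvu [K [cK KO vK]]]] := C10_truncation Omega_open Omega_bounded r0 uC.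
have bv := C10_bounded_measurable Omega_open Omega_bounded vC.
have Fv := charge_integral_fin_num f mO bv.
have near_c : \forall n \near G, (c0 - e / 2)%:E < energy f psi k Omega (a_ n).
  apply: ooG; have e2 : (0 < e / 2)%R by rewrite divr_gt0.
  have := near_infty_natSinv_lt (PosNum e2); apply: filterS => n ne.
  have [_] := aP n; apply: le_lt_trans; rewrite lee_fin lerD2l lerN2; exact: ltW.
have [vfin CIle] := weak_limit_convex_integral Omega_open Omega_bounded psi_ge0
  psi_convex psi_lsc k_gt0 psi_growth a_M GF mcvg aoptU aoptK vC cK KO vK near_c.
have FvFu : charge_integral f Omega (fun x => (u x)%:E) <=
    charge_integral f Omega (fun x => (v x)%:E) + (2 * r * C)%:E.
  by apply: HC => // x Ox; rewrite distrC; exact: vu.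
have Dvu : \int[aopt]_(x in Omega) (sqnorm_grad v x)%:E <=
    \int[aopt]_(x in Omega) (sqnorm_grad u x)%:E.
  apply: ge0_le_integral => //.
  - by move=> x _; rewrite lee_fin sqnorm_grad_ge0.
  - by apply/measurable_EFinP; exact: measurable_sqnorm_grad.
  - by apply/measurable_EFinP; exact: measurable_sqnorm_grad.
have CI0 := convex_integral_ge0 Omega_open Omega_bounded psi_ge0 psi_convex psi_lsc
  k_gt0 psi_growth aopt.
move: CI0 CIle Dvu FvFu; rewrite -(fineK vfin) -(fineK Fv) -(fineK Fu).
case: (convex_integral psi k Omega aopt) => [y| |] // _.
case: (\int[aopt]_(x in Omega) (sqnorm_grad u x)%:E) => [z| |] //; last first.
  by move=> _ _ _; rewrite gt0_muley ?lte_fin ?invr_gt0//= leey.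
rewrite -!EFinM -!EFinD !lee_fin => h1 h2 h3; lra.
Qed.
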